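(* Let $g,n\ge0$. The sequence of Lie algebras $$0\to\mathfrak{u}^f_{g,12\cdots n}\xrightarrow{\iota}\mathfrak{t}^f_{g,12\cdots n*0}\xrightarrow{\varepsilon^*}\mathfrak{t}^f_{g,12\cdots n0}\to0$$ is a split short exact sequence, with splitting $\circ_0\mathrm{id}_{*0}\colon\mathfrak{t}^f_{g,12\cdots n0}\to\mathfrak{t}^f_{g,12\cdots n*0}$. In particular, $\iota$ is injective and its image is the kernel of $\varepsilon^*$.
   Context: $\mathbb{K}$ is a field of characteristic $0$. For a finite set $I$ and $g\ge0$, $\mathfrak{t}^f_{g,I}$ is the Lie algebra over $\mathbb{K}$ generated by $t_{ij}$ ($i,j\in I$) and $x^a_i,y^a_i$ ($i\in I$, $1\le a\le g$), subject to: - $t_{ij}=t_{ji}$; - $[t_{ij},t_{kl}]=0$ if $\{i,j\}\cap\{k,l\}=\varnothing$; - $[t_{ij},t_{ik}+t_{jk}]=0$ if $k\notin\{i,j\}$; - $[x^a_i,y^b_j]=\delta_{ab}t_{ij}$ and $[x^a_i,x^b_j]=[y^a_i,y^b_j]=0$ for $i\ne j$; - $[x^a_k,t_{ij}]=[y^a_k,t_{ij}]=0$ if $k\notin\{i,j\}$; - $[x^a_i+x^a_j,t_{ij}]=[y^a_i+y^a_j,t_{ij}]=0$; - for each $i\in I$: $\sum_{a=1}^g[x^a_i,y^a_i]+\sum_{j\in I\setminus\{i\}}t_{ij}=(g-1)t_{ii}$. Here the index sets are $\{1,\dots,n,*,0\}$ and $\{1,\dots,n,0\}$. $H=\mathrm{Span}_\mathbb{K}\{t_{j*},x^a_*,y^a_*\}_{1\le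 j\le n,1\le a\le g}$ (formal symbols), and $\mathfrak{u}^f_{g,12\cdots n}=L(H)\oplus\mathbb{K}t_{**}$ is the direct sum of the free Lie algebra on $H$ and the one-dimensional abelian Lie algebra spanned by $t_{**}$. The homomorphism $\iota$ sends each generator $t_{j*},x^a_*,y^a_*,t_{**}$ to the element of $\mathfrak{t}^f_{g,12\cdots n*0}$ with the same name. $\varepsilon^*$ sends every generator carrying an index $*$ (namely $t_{i*},t_{**},x^a_*,y^a_*$) to $0$ and every other generator to the generator of the same name. $\circ_0\mathrm{id}_{*0}$ is the homomorphism with $t_{ij}\mapsto t_{ij}$ and $x^a_i\mapsto x^a_i$, $y^a_i\mapsto y^a_i$ for $1\le i,j\le n$; $t_{i0}\mapsto t_{i*}+t_{i0}$; $t_{00}\mapsto t_{**}+2t_{*0}+t_{00}$; $x^a_0\mapsto x^a_*+x^a_0$; and $y^a_0\mapsto y^a_*+y^a_0$. *)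

(* Defs.v *)
From HB Require Import structures.
From mathcomp Require Import all_boot all_order all_algebra.
Set Implicit Arguments. Unset Strict Implicit. Unset Printing Implicit Defensive.
Import GRing.Theory.
Local Open Scope ring_scope.

Record lieAlgType (K : fieldType) := LieAlg {
  lie_sort :> lmodType K;
  lie_br : lie_sort -> lie_sort -> lie_sort;
  lie_brDl : forall a x y z, lie_br (a *: x + y) z = a *: lie_br x z + lie_br y z;
  lie_brDr : forall a x y z, lie_br z (a *: x + y) = a *: lie_br z x + lie_br z y;
  lie_brxx : forall x, lie_br x x = 0;
  lie_jacobi : forall x y z,
     lie_br x (lie_br y z) + lie_br y (lie_br z x) + lie_br z (lie_br x y) = 0 }.
Arguments lie_br {K L} : rename.

Definition lie_hom (K : fieldType) (L M : lieAlgType K) (f : L -> M) : Prop :=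
  (forall (a : K) (x y : L), f (a *: x + y) = a *: f x + f y) /\
  (forall x y : L, f (lie_br x y) = lie_br (f x) (f y)).

Section Prod.
Variables (K : fieldType) (L M : lieAlgType K).
Definition prod_br (u v : (L * M)%type) : (L * M)%type :=
  (lie_br u.1 v.1, lie_br u.2 v.2).
Lemma prod_brDl a (x y z : (L * M)%type) :
  prod_br (a *: x + y) z = a *: prod_br x z + prod_br y z.
Proof. by rewrite /prod_br /= !lie_brDl. Qed.
Lemma prod_brDr a (x y z : (L * M)%type) :
  prod_br z (a *: x + y) = a *: prod_br z x + prod_br z y.
Proof. by rewrite /prod_br /= !lie_brDr. Qed.
Lemma prod_brxx (x : (L * M)%type) : prod_br x x = 0.
Proof. by rewrite /prod_br !lie_brxx. Qed.
Lemma prod_jacobi (x y z : (L * M)%type) :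
  prod_br x (prod_br y z) + prod_br y (prod_br z x) + prod_br z (prod_br x y) = 0.
Proof. by rewrite /prod_br /=; apply: injective_projections => /=; rewrite lie_jacobi. Qed.
Definition lie_prod : lieAlgType K :=
  @LieAlg K (L * M)%type prod_br prod_brDl prod_brDr prod_brxx prod_jacobi.
End Prod.

Section Line.
Variable K : fieldType.
Definition line_br (x y : K^o) : K^o := 0.
Lemma line_brDl a (x y z : K^o) : line_br (a *: x + y) z = a *: line_br x z + line_br y z.
Proof. by rewrite /line_br scaler0 addr0. Qed.
Lemma line_brDr a (x y z : K^o) : line_br z (a *: x + y) = a *: line_br z x + line_br z y.
Proof. by rewrite /line_br scaler0 addr0. Qed.
Lemma line_brxx (x : K^o) : line_br x x = 0. Proof. by []. Qed.
Lemma line_jacobi (x y z : K^o) :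
  line_br x (line_br y z) + line_br y (line_br z x) + line_br z (line_br x y) = 0.
Proof. by rewrite /line_br !addr0. Qed.
Definition lie_line : lieAlgType K :=
  @LieAlg K K^o line_br line_brDl line_brDr line_brxx line_jacobi.
End Line.

Section Terms.
Variables (K : fieldType) (X : Type).
Inductive lterm :=
| LVar of X
| LZero
| LAdd of lterm & lterm
| LScale of K & lterm
| LBr of lterm & lterm.

Fixpoint leval (L : lieAlgType K) (v : X -> L) (t : lterm) : L :=
  match t with
  | LVar x => v x
  | LZero => 0
  | LAdd s u => leval v s + leval v u
  | LScale a s => a *: leval v s
  | LBr s u => lie_br (leval v s) (leval v u)
  end.

Definition lsum (s : seq lterm) : lterm := foldr LAdd LZero s.

Definition is_presented (L : lieAlgType K) (gen : X -> L)
    (R : lterm -> lterm -> Prop) : Prop :=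
  (forall s t, R s t -> leval gen s = leval gen t) /\
  (forall (M : lieAlgType K) (phi : X -> M),
      (forall s t, R s t -> leval phi s = leval phi t) ->
      exists F : L -> M, lie_hom F /\ forall x, F (gen x) = phi x) /\
  (forall (M : lieAlgType K) (F1 F2 : L -> M), lie_hom F1 -> lie_hom F2 ->
      (forall x, F1 (gen x) = F2 (gen x)) -> forall y, F1 y = F2 y).

Definition is_free_lie (L : lieAlgType K) (gen : X -> L) : Prop :=
  is_presented gen (fun _ _ => False).
End Terms.
Arguments LZero {K X}.

(* generators: t_ij (i,j in I), x^a_i, y^a_i (a : 'I_g stands for 1 <= a <= g) *)
Inductive tgen (g : nat) (I : Type) :=
| Tg of I & I
| Xg of 'I_g & I
| Yg of 'I_g & I.

Section TRel.
Variables (K : fieldType) (g : nat) (I : finType).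
Local Notation term := (lterm K (tgen g I)).
Local Notation t i j := (LVar K (Tg g i j)).
Local Notation x a i := (LVar K (Xg a i)).
Local Notation y a i := (LVar K (Yg a i)).

Inductive tf_rel : term -> term -> Prop :=
| R_sym i j : tf_rel (t i j) (t j i)
| R_tt i j k l : i != k -> i != l -> j != k -> j != l ->
    tf_rel (LBr (t i j) (t k l)) LZero
| R_4T i j k : k != i -> k != j ->
    tf_rel (LBr (t i j) (LAdd (t i k) (t j k))) LZero
| R_xy i j a b : i != j ->
    tf_rel (LBr (x a i) (y b j)) (if a == b then t i j else LZero)
| R_xx i j a b : i != j -> tf_rel (LBr (x a i) (x b j)) LZero
| R_yy i j a b : i != j -> tf_rel (LBr (y a i) (y b j)) LZero
| R_xt i j k a : k != i -> k != j -> tf_rel (LBr (x a k) (t i j)) LZero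
| R_yt i j k a : k != i -> k != j -> tf_rel (LBr (y a k) (t i j)) LZero
| R_xxt i j a : tf_rel (LBr (LAdd (x a i) (x a j)) (t i j)) LZero
| R_yyt i j a : tf_rel (LBr (LAdd (y a i) (y a j)) (t i j)) LZero
| R_diag i :
    tf_rel (LAdd (lsum [seq LBr (x a i) (y a i) | a <- enum 'I_g])
                 (lsum [seq t i j | j <- enum I & j != i]))
           (LScale (g%:R - 1) (t i i)).

Definition is_tf (L : lieAlgType K) (gen : tgen g I -> L) : Prop :=
  is_presented gen tf_rel.
End TRel.

(* {1,...,n,0} : Some i = the point i+1,  None = 0 *)
Definition idx0 (n : nat) : finType := option 'I_n.
(* {1,...,n,*,0} : Some (Some i) = i+1,  Some None = 0,  None = * *)
Definition idxs0 (n : nat) : finType := option (option 'I_n).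
Definition zero0 {n} : idx0 n := None.
Definition pt0 {n} (i : 'I_n) : idx0 n := Some i.
Definition star {n} : idxs0 n := None.
Definition zeros {n} : idxs0 n := Some None.
Definition pts {n} (i : 'I_n) : idxs0 n := Some (Some i).

(* basis of H: t_{j*} (j in 1..n), x^a_*, y^a_* *)
Inductive ugen (g n : nat) :=
| UT of 'I_n
| UX of 'I_g
| UY of 'I_g.

Section Maps.
Variables (K : fieldType) (g n : nat).
Variables (LH : lieAlgType K) (hgen : ugen g n -> LH).
Variables (T : lieAlgType K) (tg : tgen g (idxs0 n) -> T).
Variables (T' : lieAlgType K) (tg' : tgen g (idx0 n) -> T').

(* u^f = L(H) (+) K t_** *)
Definition uf : lieAlgType K := lie_prod LH (lie_line K).

Definition iota_H (h : ugen g n) : T :=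
  match h with
  | UT j => tg (Tg g (pts j) star)
  | UX a => tg (Xg a star)
  | UY a => tg (Yg a star)
  end.
Definition is_iota (iota : uf -> T) : Prop :=
  lie_hom iota /\
  (forall h, iota (hgen h, 0) = iota_H h) /\
  iota (0, 1) = tg (Tg g star star).

Definition eps_gen (z : tgen g (idxs0 n)) : T' :=
  match z with
  | Tg (Some i) (Some j) => tg' (Tg g i j)
  | Tg _ _ => 0
  | Xg a (Some i) => tg' (Xg a i)
  | Xg _ None => 0
  | Yg a (Some i) => tg' (Yg a i)
  | Yg _ None => 0
  end.
Definition is_eps (eps : T -> T') : Prop :=
  lie_hom eps /\ forall z, eps (tg z) = eps_gen z.

Definition sec_gen (z : tgen g (idx0 n)) : T :=
  match z with
  | Tg (Some i) (Some j) => tg (Tg g (pts i) (pts j))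
  | Tg (Some i) None => tg (Tg g (pts i) star) + tg (Tg g (pts i) zeros)
  | Tg None (Some j) => tg (Tg g star (pts j)) + tg (Tg g zeros (pts j))
  | Tg None None =>
      tg (Tg g star star) + 2%:R *: tg (Tg g star zeros) + tg (Tg g zeros zeros)
  | Xg a (Some i) => tg (Xg a (pts i))
  | Xg a None => tg (Xg a star) + tg (Xg a zeros)
  | Yg a (Some i) => tg (Yg a (pts i))
  | Yg a None => tg (Yg a star) + tg (Yg a zeros)
  end.
Definition is_sec (s : T' -> T) : Prop :=
  lie_hom s /\ forall z, s (tg' z) = sec_gen z.
End Maps.

(* Main.v *)
(* Write u for u^f. The nontrivial point is the injectivity of iota. The adjoint
   action of t^f_{1..n*0} on the ideal generated by the strand [*] is given on
   generators by explicit formulas, and these formulas define derivations of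
   u = L(H) + K t_** because L(H) is free. They see u only modulo its centre, so
   one maps t^f_{1..n*0} to the semidirect product of u and Der(u) instead: a
   generator of the strand [*] goes to (- v, ad v), for v the corresponding
   element of u, and any other generator z goes to (sigma_z, ad z), where
   sigma_z is the image of z under the section, minus z. This respects the
   relations, and its composite with iota is the injective map v |-> (- v, ad v).

   Exactness in the middle: the image of iota is an ideal and, together with the
   image of the section, it contains all generators, so every element of the
   algebra is iota u + s z; if eps kills it, then z = 0. *)
Require Import Defs.
From HB Require Import structures.
From mathcomp Require Import all_boot all_order all_algebra.
From mathcomp Require Import boolp functions.
Set Implicit Arguments.
Unset Strict Implicit.
Unset Printing Implicit Defensive.
Import GRing.Theory.
Local Open Scope ring_scope.

Local Notation "{[ x , y ]}" := (lie_br x y) (at level 0, x, y at level 99).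

(* Equalities that hold in every abelian group, by comparing the integer
   coefficients of the atoms. *)
Section ZmodNormal.
Variable V : zmodType.

Inductive zexp := ZVar of nat | ZZero | ZAdd of zexp & zexp | ZOpp of zexp.

Fixpoint zeval (env : seq V) e : V :=
  match e with
  | ZVar i => env`_i
  | ZZero => 0
  | ZAdd e1 e2 => zeval env e1 + zeval env e2
  | ZOpp e1 => - zeval env e1
  end.

Fixpoint zcoef e (i : nat) : int :=
  match e with
  | ZVar j => (i == j)%:Z
  | ZZero => 0
  | ZAdd e1 e2 => zcoef e1 i + zcoef e2 i
  | ZOpp e1 => - zcoef e1 i
  end.

Lemma zevalE env e : zeval env e = \sum_(i < size env) env`_i *~ zcoef e i.
Proof.
elim: e => [j||e1 IH1 e2 IH2|e1 IH1] /=.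
- have [lt_j|ge_j] := ltnP j (size env).
    rewrite (bigD1 (Ordinal lt_j)) //= eqxx big1 ?addr0 // => i.
    by rewrite -val_eqE /= => /negPf->.
  rewrite nth_default // big1 // => i _.
  by rewrite (ltn_eqF (leq_trans (ltn_ord i) ge_j)).
- by rewrite big1.
- by rewrite IH1 IH2 -big_split; apply: eq_bigr => i _; rewrite mulrzDr.
- by rewrite IH1 -sumrN; apply: eq_bigr => i _; rewrite mulrNz.
Qed.

Lemma zeval_eq env e1 e2 :
  all (fun i => zcoef e1 i == zcoef e2 i) (iota 0 (size env)) ->
  zeval env e1 = zeval env e2.
Proof.
move=> /allP eq12; rewrite !zevalE; apply: eq_bigr => i _.
by rewrite (eqP (eq12 i _)) // mem_iota /= add0n.
Qed.
End ZmodNormal.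

(** Atoms are identified up to unification rather than syntactically; the inner [match goal] makes
    [unify] run while a term is being built. *)
Ltac zmem x env :=
  lazymatch env with
  | nil => constr:(false)
  | ?y :: ?env' =>
    match goal with
    | _ => let _ := match goal with _ => unify x y end in constr:(true)
    | _ => zmem x env'
    end
  end.
Ltac zatoms env e :=
  lazymatch e with
  | ?a + ?b => let env := zatoms env a in zatoms env b
  | - ?a => zatoms env a
  | 0 => env
  | _ => lazymatch zmem e env with true => env | false => constr:(e :: env) end
  end.
Ltac zindex x env :=
  lazymatch env with
  | ?y :: ?env' =>
    match goal with
    | _ => let _ := match goal with _ => unify x y end in constr:(0%N)
    | _ => let i := zindex x env' in constr:(i.+1)
    end
  end.
Ltac zquote env e :=
  lazymatch e with
  | ?a + ?b =>
    let a := zquote env a in let b := zquote env b in constr:(ZAdd a b)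
  | - ?a => let a := zquote env a in constr:(ZOpp a)
  | 0 => constr:(ZZero)
  | _ => let i := zindex e env in constr:(ZVar i)
  end.
(** Proof by reflection: [isT] is accepted because the comparison of coefficients evaluates to
    [true], and the goal is convertible to the interpretation of the two quoted expressions. *)
Ltac zmod :=
  lazymatch goal with
  | |- @eq ?T ?a ?b =>
    let env := zatoms (@nil T) a in
    let env := zatoms env b in
    let ea := zquote env a in
    let eb := zquote env b in
    exact (@zeval_eq _ env ea eb isT)
  end.

(** * Bracket calculus and Lie homomorphisms *)

Section LieAlgebraTheory.
Variables (K : fieldType) (L : lieAlgType K).
Implicit Types x y z : L.

HB.instance Definition _ x :=
  GRing.isLinear.Build K L L *:%R (lie_br x) (fun a y z => lie_brDr a y z x).

Lemma br0r x : {[x, 0]} = 0. Proof. exact: linear0. Qed.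
Lemma brDr x y z : {[x, y + z]} = {[x, y]} + {[x, z]}.
Proof. exact: linearD. Qed.
Lemma brNr x y : {[x, - y]} = - {[x, y]}. Proof. exact: linearN. Qed.
Lemma brBr x y z : {[x, y - z]} = {[x, y]} - {[x, z]}.
Proof. exact: linearB. Qed.
Lemma brZr a x y : {[x, a *: y]} = a *: {[x, y]}. Proof. exact: linearZ. Qed.
Lemma br_sumr I r (P : pred I) (F : I -> L) x :
  {[x, \sum_(i <- r | P i) F i]} = \sum_(i <- r | P i) {[x, F i]}.
Proof. exact: linear_sum. Qed.

Lemma brC x y : {[x, y]} = - {[y, x]}.
Proof.
have addl a b c : {[a + b, c]} = {[a, c]} + {[b, c]}.
  by rewrite -[a]scale1r lie_brDl !scale1r.
apply/eqP; rewrite -addr_eq0; have := lie_brxx (x + y).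
by rewrite addl !brDr !lie_brxx add0r addr0 => ->.
Qed.

Lemma br0l x : {[0, x]} = 0. Proof. by rewrite brC br0r oppr0. Qed.
Lemma brDl x y z : {[x + y, z]} = {[x, z]} + {[y, z]}.
Proof. by rewrite brC brDr opprD -!brC. Qed.
Lemma brNl x y : {[- x, y]} = - {[x, y]}.
Proof. by rewrite brC brNr opprK brC. Qed.
Lemma brBl x y z : {[x - y, z]} = {[x, z]} - {[y, z]}.
Proof. by rewrite brDl brNl. Qed.
Lemma brZl a x y : {[a *: x, y]} = a *: {[x, y]}.
Proof. by rewrite brC brZr -scalerN -brC. Qed.
Lemma br_suml I r (P : pred I) (F : I -> L) x :
  {[\sum_(i <- r | P i) F i, x]} = \sum_(i <- r | P i) {[F i, x]}.
Proof. by rewrite brC br_sumr -sumrN; apply: eq_bigr => i _; rewrite -brC. Qed.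

Lemma br_brr x y z : {[x, {[y, z]}]} = {[{[x, y]}, z]} + {[y, {[x, z]}]}.
Proof.
apply/eqP; rewrite [{[{[x, y]}, z]}]brC [{[x, z]}]brC brNr -opprD -addr_eq0.
by rewrite addrA addrAC lie_jacobi.
Qed.

Lemma br_brl x y z : {[{[x, y]}, z]} = {[x, {[y, z]}]} - {[y, {[x, z]}]}.
Proof. by rewrite br_brr addrK. Qed.

End LieAlgebraTheory.

Section LieHomTheory.
Variables (K : fieldType) (L M : lieAlgType K) (f : L -> M).
Hypothesis hf : lie_hom f.

Lemma lie_homP a x y : f (a *: x + y) = a *: f x + f y. Proof. exact: hf.1. Qed.
Lemma lie_hom_br x y : f {[x, y]} = {[f x, f y]}. Proof. exact: hf.2. Qed.
Lemma lie_homD x y : f (x + y) = f x + f y.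
Proof. by rewrite -[x]scale1r hf.1 !scale1r. Qed.
Lemma lie_hom0 : f 0 = 0.
Proof. by apply: (addrI (f 0)); rewrite -lie_homD !addr0. Qed.
Lemma lie_homZ a x : f (a *: x) = a *: f x.
Proof. by rewrite -[a *: x]addr0 hf.1 lie_hom0 addr0. Qed.
Lemma lie_homN x : f (- x) = - f x.
Proof. by rewrite -scaleN1r lie_homZ scaleN1r. Qed.
Lemma lie_homB x y : f (x - y) = f x - f y.
Proof. by rewrite lie_homD lie_homN. Qed.
Lemma lie_hom_sum I r (P : pred I) (F : I -> L) :
  f (\sum_(i <- r | P i) F i) = \sum_(i <- r | P i) f (F i).
Proof. exact: (big_morph f lie_homD lie_hom0). Qed.

Lemma leval_hom X (v : X -> L) t : leval (f \o v) t = f (leval v t).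
Proof.
elim: t => //= [|s IHs t IHt|a s IHs|s IHs t IHt].
- by rewrite lie_hom0.
- by rewrite lie_homD IHs IHt.
- by rewrite lie_homZ IHs.
- by rewrite lie_hom_br IHs IHt.
Qed.

End LieHomTheory.

Lemma lie_hom_id K (L : lieAlgType K) : lie_hom (@id L).
Proof. by []. Qed.

Lemma lie_hom_comp K (L M N : lieAlgType K) (f : M -> N) (h : L -> M) :
  lie_hom f -> lie_hom h -> lie_hom (f \o h).
Proof.
move=> hf hh; split=> *.
  by rewrite /= (lie_homP hh) (lie_homP hf).
by rewrite /= (lie_hom_br hh) (lie_hom_br hf).
Qed.

Lemma leval_lsum K (L : lieAlgType K) X (v : X -> L) s :
  leval v (lsum s) = \sum_(t <- s) leval v t.
Proof. by elim: s => [|t s IHs]; rewrite ?big_nil // big_cons /= IHs. Qed.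

(** * Lie subalgebras and induction on generators *)

Section Subalgebra.
Variables (K : fieldType) (L : lieAlgType K) (S : L -> Prop).
Hypotheses (S0 : S 0) (SD : forall a x y, S x -> S y -> S (a *: x + y)).
Hypothesis Sbr : forall x y, S x -> S y -> S {[x, y]}.

(** Classical reflection makes the arbitrary predicate [S] boolean, so that the subtype structures
    apply to it. *)
Definition in_sub : pred L := fun x => `[< S x >].

Lemma in_sub_closed : submod_closed in_sub.
Proof.
split; first exact/asboolP.
by move=> a x y /asboolP Sx /asboolP Sy; apply/asboolP/SD.
Qed.
HB.instance Definition _ := GRing.isSubmodClosed.Build K L in_sub in_sub_closed.

Record sub_sort := Sub_sort { sub_val : L; sub_valP : sub_val \in in_sub }.
HB.instance Definition _ := [isSub for sub_val].
HB.instance Definition _ := [Choice of sub_sort by <:].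
HB.instance Definition _ := [SubChoice_isSubLmodule of sub_sort by <:].

Lemma sub_br_subproof (x y : sub_sort) : {[val x, val y]} \in in_sub.
Proof.
apply/asboolP; apply: Sbr; apply/asboolP;
  [exact: (sub_valP x)|exact: (sub_valP y)].
Qed.
Definition sub_br x y := Sub_sort (sub_br_subproof x y).

Lemma sub_brDl a x y z : sub_br (a *: x + y) z = a *: sub_br x z + sub_br y z.
Proof. by apply: val_inj; exact: lie_brDl. Qed.
Lemma sub_brDr a x y z : sub_br z (a *: x + y) = a *: sub_br z x + sub_br z y.
Proof. by apply: val_inj; exact: lie_brDr. Qed.
Lemma sub_brxx x : sub_br x x = 0.
Proof. by apply: val_inj; exact: lie_brxx. Qed.
Lemma sub_jacobi x y z :
  sub_br x (sub_br y z) + sub_br y (sub_br z x) + sub_br z (sub_br x y) = 0.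
Proof. by apply: val_inj; exact: lie_jacobi. Qed.

Definition lie_sub : lieAlgType K :=
  LieAlg sub_brDl sub_brDr sub_brxx sub_jacobi.

Lemma sub_val_hom : lie_hom (sub_val : lie_sub -> L).
Proof. by split. Qed.

End Subalgebra.

Section Presented.
Variables (K : fieldType) (X : Type) (L : lieAlgType K) (gen : X -> L).
Variable R : lterm K X -> lterm K X -> Prop.
Hypothesis HL : is_presented gen R.

Lemma presented_rel s t : R s t -> leval gen s = leval gen t.
Proof. exact: HL.1. Qed.

Lemma presented_ext (M : lieAlgType K) (F1 F2 : L -> M) :
  lie_hom F1 -> lie_hom F2 -> (forall x, F1 (gen x) = F2 (gen x)) -> F1 =1 F2.
Proof. by move=> h1 h2 e; apply: HL.2.2. Qed.

(** The generators lie in the subalgebra cut out by [S], and the relations hold there because the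
    inclusion is injective. The universal property gives a map from [L] to this subalgebra; followed
    by the inclusion it fixes the generators, so it is the identity by uniqueness. *)
Lemma presented_ind (S : L -> Prop) :
    S 0 -> (forall a x y, S x -> S y -> S (a *: x + y)) ->
    (forall x y, S x -> S y -> S {[x, y]}) ->
  (forall x, S (gen x)) -> forall y, S y.
Proof.
move=> S0 SD Sbr Sgen.
have Sg x : gen x \in in_sub S by apply/asboolP.
pose M := lie_sub S0 SD Sbr.
pose phi x : M := Sub_sort (Sg x).
have hv : lie_hom (@sub_val _ _ _ : M -> L) by exact: sub_val_hom.
have phiR s t : R s t -> leval phi s = leval phi t.
  by move=> /presented_rel e; apply: val_inj; rewrite /= -!(leval_hom hv).
have [F [hF FE]] := HL.2.1 M phi phiR.
move=> y; have <- : sub_val (F y) = y.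
  apply: (presented_ext (lie_hom_comp hv hF) (lie_hom_id L)) => x /=.
  by rewrite FE.
by apply/asboolP; exact: (sub_valP (F y)).
Qed.

End Presented.

(** * Semidirect products and the Lie algebra of derivations *)

Section Semidirect.
Variables (K : fieldType) (A G : lieAlgType K) (act : G -> A -> A).
Hypothesis act_l : forall a x y v, act (a *: x + y) v = a *: act x v + act y v.
Hypothesis act_r : forall a x v w, act x (a *: v + w) = a *: act x v + act x w.
Hypothesis act_der :
  forall x v w, act x {[v, w]} = {[act x v, w]} + {[v, act x w]}.
Hypothesis act_br :
  forall x y v, act {[x, y]} v = act x (act y v) - act y (act x v).

Definition sdir_br (p q : (A * G)%type) : (A * G)%type :=
  ({[p.1, q.1]} + (act p.2 q.1 - act q.2 p.1), {[p.2, q.2]}).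

Lemma sdir_brxx p : sdir_br p p = 0.
Proof. by rewrite /sdir_br !lie_brxx subrr add0r. Qed.

Lemma sdir_brDr a p q r :
  sdir_br r (a *: p + q) = a *: sdir_br r p + sdir_br r q.
Proof.
rewrite /sdir_br; congr pair; last by rewrite /= lie_brDr.
by rewrite /= lie_brDr act_l act_r !(scalerDr, scalerN); zmod.
Qed.

Lemma sdir_brDl a p q r :
  sdir_br (a *: p + q) r = a *: sdir_br p r + sdir_br q r.
Proof.
rewrite /sdir_br; congr pair; last by rewrite /= lie_brDl.
by rewrite /= lie_brDl act_l act_r !(scalerDr, scalerN); zmod.
Qed.

Lemma sdir_jacobi p q r :
  sdir_br p (sdir_br q r) + sdir_br q (sdir_br r p) + sdir_br r (sdir_br p q) =
    0.
Proof.
have actD x v w : act x (v + w) = act x v + act x w.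
  by rewrite -[v]scale1r act_r !scale1r.
have act0 x : act x 0 = 0 by apply: (addrI (act x 0)); rewrite -actD !addr0.
have actN x v : act x (- v) = - act x v.
  by apply/eqP; rewrite -addr_eq0 -actD addNr act0.
case: p q r => [a x] [b y] [c z]; rewrite /sdir_br;
  apply: injective_projections.
  rewrite /= !(actD, actN, act_der, act_br, brDr, brNr).
  (* The Jacobi identity of [A] is used here once; the rewriting below only orients the remaining
     brackets, so that equal ones become the same atom. *)
  rewrite [{[c, {[a, b]}]}]br_brr.
  rewrite [{[c, a]}]brC [{[c, b]}]brC ![{[_, act _ _]}]brC !(brNl, brNr).
  by rewrite [{[{[a, c]}, b]}]brC; zmod.
by rewrite /= lie_jacobi.
Qed.

Definition lie_sdir : lieAlgType K :=
  LieAlg sdir_brDl sdir_brDr sdir_brxx sdir_jacobi.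
End Semidirect.

(** The homomorphism [f] makes [M] a module over [L]. This generality serves for derivations of L(H)
    with values in u, along the inclusion. *)
Definition lie_der (K : fieldType) (L M : lieAlgType K) (f d : L -> M) : Prop :=
  (forall (a : K) (x y : L), d (a *: x + y) = a *: d x + d y) /\
  (forall x y : L, d {[x, y]} = {[d x, f y]} + {[f x, d y]}).

Section Derivations.
Variables (K : fieldType) (L : lieAlgType K).

Definition in_der : pred (L -> L) := fun d => `[< lie_der id d >].

Lemma in_der_closed : submod_closed in_der.
Proof.
split=> [|a d e /asboolP[dD db] /asboolP[eD eb]]; apply/asboolP; split.
- by move=> a x y; change (0 = a *: 0 + 0 :> L); rewrite scaler0 addr0.
- move=> x y; change (0 = {[0, y]} + {[x, 0]}).
  by rewrite br0l br0r addr0.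
- move=> b x y.
  change (a *: d (b *: x + y) + e (b *: x + y) =
          b *: (a *: d x + e x) + (a *: d y + e y)).
  by rewrite dD eD !scalerDr !scalerA mulrC; zmod.
- move=> x y.
  change (a *: d {[x, y]} + e {[x, y]} =
          {[a *: d x + e x, y]} + {[x, a *: d y + e y]}).
  by rewrite db eb !(brDl, brDr, brZl, brZr) scalerDr; zmod.
Qed.
HB.instance Definition _ :=
  GRing.isSubmodClosed.Build K (L -> L) in_der in_der_closed.

Record der_sort := Der_sort { der_val :> L -> L;
  der_valP : der_val \in in_der }.
HB.instance Definition _ := [isSub for der_val].
HB.instance Definition _ := [Choice of der_sort by <:].
HB.instance Definition _ := [SubChoice_isSubLmodule of der_sort by <:].

Implicit Types d e : der_sort.

Lemma der_sortP d : lie_der id d. Proof. exact/asboolP/(der_valP d). Qed.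

Lemma derP d a x y : d (a *: x + y) = a *: d x + d y.
Proof. exact: (der_sortP d).1. Qed.
Lemma der_br d x y : d {[x, y]} = {[d x, y]} + {[x, d y]}.
Proof. exact: (der_sortP d).2. Qed.

HB.instance Definition _ d := GRing.isLinear.Build K L L *:%R d (derP d).

Lemma der_eqP d e : d =1 e -> d = e.
Proof. by move=> de; apply/val_inj/funext. Qed.

Lemma der_br_subproof d e : (fun x => d (e x) - e (d x)) \in in_der.
Proof.
apply/asboolP; split=> [a x y|x y]; first by rewrite !derP scalerBr; zmod.
by rewrite !der_br !linearD /= !der_br !(brBl, brNr); zmod.
Qed.
Definition der_comm d e := Der_sort (der_br_subproof d e).

Lemma der_commDl a d1 d2 e :
  der_comm (a *: d1 + d2) e = a *: der_comm d1 e + der_comm d2 e.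
Proof.
apply: der_eqP => x; change ((a *: d1 (e x) + d2 (e x)) - e (a *: d1 x + d2 x) =
  a *: (d1 (e x) - e (d1 x)) + (d2 (e x) - e (d2 x))).
by rewrite derP scalerBr; zmod.
Qed.
Lemma der_commDr a d1 d2 e :
  der_comm e (a *: d1 + d2) = a *: der_comm e d1 + der_comm e d2.
Proof.
apply: der_eqP => x; change (e (a *: d1 x + d2 x) - (a *: d1 (e x) + d2 (e x)) =
  a *: (e (d1 x) - d1 (e x)) + (e (d2 x) - d2 (e x))).
by rewrite derP scalerBr; zmod.
Qed.
Lemma der_commxx d : der_comm d d = 0.
Proof. by apply: der_eqP => x; rewrite /= subrr. Qed.
Lemma der_comm_jacobi d e f :
  der_comm d (der_comm e f) + der_comm e (der_comm f d) +
    der_comm f (der_comm d e) = 0.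
Proof.
apply: der_eqP => x; pose D := fun u v : der_sort => fun y => u (v y) - v (u y).
change (d (D e f x) - D e f (d x) + (e (D f d x) - D f d (e x)) +
  (f (D d e x) - D d e (f x)) = 0).
by rewrite /D !linearB /=; zmod.
Qed.

Definition lie_Der : lieAlgType K :=
  LieAlg der_commDl der_commDr der_commxx der_comm_jacobi.

Lemma ad_subproof x : lie_br x \in in_der.
Proof.
by apply/asboolP; split=> [a y z|y z]; [exact: lie_brDr|exact: br_brr].
Qed.
Definition ad x : lie_Der := Der_sort (ad_subproof x).

Lemma ad_hom : lie_hom ad.
Proof.
split=> [a x y|x y]; apply: der_eqP => z; first exact: lie_brDl.
exact: br_brl.
Qed.

End Derivations.

(** * Derivations out of a free Lie algebra *)

Section FreeDerivation.
Variables (K : fieldType) (X : Type) (L : lieAlgType K) (gen : X -> L).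
Hypothesis HL : is_free_lie gen.
Variables (M : lieAlgType K) (f : L -> M).
Hypothesis hf : lie_hom f.

Definition abel_br (V : lmodType K) (x y : V) : V := 0.
Definition lie_abel (V : lmodType K) : lieAlgType K.
Proof.
by exists V (@abel_br V) => *; rewrite /abel_br ?scaler0 ?addr0.
Defined.

(* The dual numbers [M + eps M]; a derivation [d] along [f] is the same as a
   homomorphism [f + eps d]. *)
Definition lie_dual : lieAlgType K.
Proof.
apply: (@lie_sdir K (lie_abel M) M (fun x y => {[x, y : M]} : lie_abel M)).
- by move=> a x y v; rewrite lie_brDl.
- by move=> a x v w; rewrite lie_brDr.
- by move=> x v w; rewrite /= /abel_br br0r addr0.
- by move=> x y v; rewrite br_brl.
Defined.

Lemma lie_dual_hom (d : L -> M) :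
  lie_der f d -> lie_hom (fun x => (d x, f x) : lie_dual).
Proof.
move=> [dD db]; split=> [a x y|x y]; first by rewrite dD (lie_homP hf).
by rewrite db (lie_hom_br hf) [{[d x, _]}]brC; congr pair; rewrite /= /abel_br;
  zmod.
Qed.

Lemma free_der_ext (d e : L -> M) : lie_der f d -> lie_der f e ->
  (forall x, d (gen x) = e (gen x)) -> d =1 e.
Proof.
move=> /lie_dual_hom hd /lie_dual_hom he de x.
have /= := presented_ext HL hd he _ x.
by move=> /(_ (fun y => congr1 (pair^~ (f (gen y))) (de y))) [].
Qed.

(** By freeness there is a homomorphism to the dual numbers with the values [(d0 x, f (gen x))]. Its
    second component is [f] by uniqueness, so its first component is a derivation along [f]. *)
Lemma free_der (d0 : X -> M) :
  exists d, lie_der f d /\ forall x, d (gen x) = d0 x.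
Proof.
have [|F [hF FE]] := HL.2.1 lie_dual (fun x => (d0 x, f (gen x))); first by [].
have F2 x : (F x).2 = f x.
  have h2 : lie_hom (fun x => (F x).2 : M).
    by split=> [a y z|y z]; rewrite (lie_homP hF, lie_hom_br hF).
  by apply: (presented_ext HL h2 hf) => y; rewrite FE.
exists (fun x => (F x).1); split=> [|x]; last by rewrite FE.
split=> [a x y|x y]; first by rewrite (lie_homP hF).
by rewrite (lie_hom_br hF) /= !F2 (@brC _ M (F x).1) /abel_br; zmod.
Qed.

End FreeDerivation.

(** * Consequences of the relations of t^f, and functoriality in the index set *)

Lemma leval_tf_diag K (L : lieAlgType K) g (I : finType) (v : tgen g I -> L) i :
  leval v (LAdd (lsum [seq LBr (LVar K (Xg a i)) (LVar K (Yg a i)) | a <- enum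
    'I_g])
                (lsum [seq LVar K (Tg g i j) | j <- enum I & j != i])) =
  \sum_a {[v (Xg a i), v (Yg a i)]} + \sum_(j | j != i) v (Tg g i j).
Proof.
rewrite [LHS]/(leval v (lsum _) + leval v (lsum _)) !leval_lsum !big_map.
by congr (_ + _); rewrite big_filter big_enum_cond.
Qed.

Section TfTheory.
Variables (K : fieldType) (g : nat) (I : finType).
Variables (L : lieAlgType K) (gen : tgen g I -> L).
Hypothesis char0 : [pchar K] =i pred0.
Hypothesis genR : forall s t, tf_rel s t -> leval gen s = leval gen t.

Local Notation t i j := (gen (Tg g i j)).
Local Notation x a i := (gen (Xg a i)).
Local Notation y a i := (gen (Yg a i)).

Lemma tf_tC i j : t i j = t j i.
Proof. exact: (genR (R_sym K g i j)). Qed.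
Lemma tf_tt i j k l : i != k -> i != l -> j != k -> j != l -> {[t i j, t k l]} =
  0.
Proof. by move=> ik il jk jl; exact: (genR (R_tt K g ik il jk jl)). Qed.
Lemma tf_4T i j k : k != i -> k != j -> {[t i j, t i k + t j k]} = 0.
Proof. by move=> ki kj; exact: (genR (R_4T K g ki kj)). Qed.
Lemma tf_xy i j a b : i != j -> {[x a i, y b j]} = if a == b then t i j else 0.
Proof. by move=> ij; have /= := genR (R_xy K a b ij); case: eqP. Qed.
Lemma tf_xx i j a b : i != j -> {[x a i, x b j]} = 0.
Proof. by move=> ij; exact: (genR (R_xx K a b ij)). Qed.
Lemma tf_yy i j a b : i != j -> {[y a i, y b j]} = 0.
Proof. by move=> ij; exact: (genR (R_yy K a b ij)). Qed.
Lemma tf_xt i j k a : k != i -> k != j -> {[x a k, t i j]} = 0.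
Proof. by move=> ki kj; exact: (genR (R_xt K a ki kj)). Qed.
Lemma tf_yt i j k a : k != i -> k != j -> {[y a k, t i j]} = 0.
Proof. by move=> ki kj; exact: (genR (R_yt K a ki kj)). Qed.
Lemma tf_xxt i j a : {[x a i + x a j, t i j]} = 0.
Proof. exact: (genR (R_xxt K i j a)). Qed.
Lemma tf_yyt i j a : {[y a i + y a j, t i j]} = 0.
Proof. exact: (genR (R_yyt K i j a)). Qed.
Lemma tf_diag i :
  \sum_a {[x a i, y a i]} + \sum_(j | j != i) t i j = (g%:R - 1) *: t i i.
Proof. by rewrite -leval_tf_diag (genR (R_diag K g i)). Qed.

(** Characteristic 0 enters here, through the invertibility of 2. *)
Lemma double_eq0 (v : L) : v + v = 0 -> v = 0.
Proof.
have n2 : (2%:R : K) != 0 by have /pcharf0P -> := char0.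
by move=> /eqP; rewrite -mulr2n -scaler_nat scaler_eq0 (negPf n2) => /eqP.
Qed.

(** With two equal indices the four-term relation reads [t_ii, 2 t_ik] = 0, and the relations
    between x or y and t read [2 x_i, t_ii] = [2 y_i, t_ii] = 0. Disjoint indices commute by the
    other relations. *)
Lemma tf_tii_gen i z : {[t i i, gen z]} = 0.
Proof.
have tik k : {[t i i, t i k]} = 0.
  have [->|ki] := eqVneq k i; first exact: lie_brxx.
  by apply: double_eq0; rewrite -brDr tf_4T.
case: z => [k l|a k|a k].
- have [->//|ki] := eqVneq k i; have [->|li] := eqVneq l i.
    by rewrite tf_tC.
  by apply: tf_tt; rewrite eq_sym.
- rewrite brC; apply/eqP; rewrite oppr_eq0; apply/eqP.
  have [->|ki] := eqVneq k i; last exact: tf_xt.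
  by apply: double_eq0; rewrite -brDl tf_xxt.
- rewrite brC; apply/eqP; rewrite oppr_eq0; apply/eqP.
  have [->|ki] := eqVneq k i; last exact: tf_yt.
  by apply: double_eq0; rewrite -brDl tf_yyt.
Qed.

(** Only the summands [l = i] and [l = j] contribute, and these cancel by the four-term relation;
    for [i = j] every summand commutes with t_ii. In the pullback, [A] is a fibre or the union of
    two fibres. *)
Lemma tf_4T_sum (A : pred I) i j k :
  A i -> A j -> ~~ A k -> {[t i j, \sum_(l | A l) t l k]} = 0.
Proof.
move=> Ai Aj Ak; have neqk l : A l -> k != l by apply: contraTneq => <-.
rewrite br_sumr; have [<-|ij] := eqVneq i j.
  by apply: big1 => l _; exact: tf_tii_gen.
rewrite (bigD1 i) //= (bigD1 j) ?Aj 1?eq_sym //= big1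
  => [|l /andP[/andP[Al li] lj]].
  by rewrite addr0 -brDr tf_4T ?neqk.
by apply: tf_tt; rewrite // eq_sym ?neqk.
Qed.

Lemma tf_xxt_sum (A : pred I) i j a :
  A i -> A j -> {[\sum_(l | A l) x a l, t i j]} = 0.
Proof.
move=> Ai Aj; rewrite br_suml; have [<-|ij] := eqVneq i j.
  by apply: big1 => l _; rewrite brC tf_tii_gen oppr0.
rewrite (bigD1 i) //= (bigD1 j) ?Aj 1?eq_sym //= big1
  => [|l /andP[/andP[_ li] lj]].
  by rewrite addr0 -brDl tf_xxt.
exact: tf_xt.
Qed.

Lemma tf_yyt_sum (A : pred I) i j a :
  A i -> A j -> {[\sum_(l | A l) y a l, t i j]} = 0.
Proof.
move=> Ai Aj; rewrite br_suml; have [<-|ij] := eqVneq i j.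
  by apply: big1 => l _; rewrite brC tf_tii_gen oppr0.
rewrite (bigD1 i) //= (bigD1 j) ?Aj 1?eq_sym //= big1
  => [|l /andP[/andP[_ li] lj]].
  by rewrite addr0 -brDl tf_yyt.
exact: tf_yt.
Qed.

(* A map [f : I -> J] of index sets induces a homomorphism in the other
   direction, summing over the fibres of [f]. Both [eps^*] (for the inclusion
   of the points other than [*]) and the section (for the map sending [*] to
   [0]) arise this way. *)
Section Pullback.
Variables (J : finType) (f : I -> J).

Definition tf_pull (z : tgen g J) : L :=
  match z with
  | Tg i j => \sum_(p | f p == i) \sum_(q | f q == j) t p q
  | Xg a i => \sum_(p | f p == i) x a p
  | Yg a i => \sum_(p | f p == i) y a p
  end.

Lemma fibreU (F : I -> L) i j : i != j ->
  \sum_(p | f p == i) F p + \sum_(p | f p == j) F p =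
  \sum_(p | (f p == i) || (f p == j)) F p.
Proof.
move=> ij; rewrite [RHS](bigID (fun p => f p == i)) /=; congr (_ + _).
  by apply: eq_bigl => p; case: eqP; rewrite ?andbF.
apply: eq_bigl => p; case: eqP => [->|]; last by rewrite orbF andbN.
by rewrite eq_sym (negPf ij).
Qed.

(** The left side expands over pairs of points. For p in the fibre of [i], the relation at p turns
    the brackets [x_p^a, y_p^a] into (g - 1) t_pp minus all t_pq with q != p. The terms with q
    outside the fibre then cancel; for q inside, the brackets [x_p^a, y_q^a] add g t_pq, which
    leaves the factor g - 1. *)
Lemma tf_pull_diag i :
  \sum_a {[tf_pull (Xg a i), tf_pull (Yg a i)]}
    + \sum_(j | j != i) tf_pull (Tg g i j) = (g%:R - 1) *: tf_pull (Tg g i i).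
Proof.
have -> : \sum_a {[tf_pull (Xg a i), tf_pull (Yg a i)]} =
    \sum_(p | f p == i) \sum_(q | f q == i) \sum_a {[x a p, y a q]}.
  under eq_bigr do rewrite br_suml.
  rewrite exchange_big; apply: eq_bigr => p _.
  by under eq_bigr do rewrite br_sumr; rewrite exchange_big.
have -> : \sum_(j | j != i) tf_pull (Tg g i j) =
    \sum_(p | f p == i) \sum_(q | f q != i) t p q.
  rewrite exchange_big; apply: eq_bigr => p _.
  rewrite (partition_big f (fun j => j != i)) //=; apply: eq_bigr => j ji.
  by apply: eq_bigl => q; case: eqP => [->|]; rewrite ?ji ?andbF.
rewrite -big_split scaler_sumr; apply: eq_bigr => p fp /=.
rewrite (bigD1 p) //= [in RHS](bigD1 p) //= scalerDr -tf_diag -!addrA.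
congr (_ + _); rewrite [in RHS](bigID (fun q => f q == i)) /=.
have -> : \sum_(q | (f q == i) && (q != p)) \sum_a {[x a p, y a q]} =
    g%:R *: \sum_(q | (f q == i) && (q != p)) t p q.
  rewrite scaler_sumr; apply: eq_bigr => q /andP[_ qp].
  have pq : p != q by rewrite eq_sym.
  rewrite (eq_bigr (fun=> t p q)) => [|a _]; last by rewrite tf_xy // eqxx.
  by rewrite sumr_const card_ord scaler_nat.
rewrite scalerBl scale1r.
rewrite [X in _ = X + _ + _](eq_bigl (fun q => (f q == i) && (q != p)));
  last first.
  by move=> q; rewrite andbC.
rewrite [X in _ = _ + X + _](eq_bigl (fun q => f q != i)); first by zmod.
by move=> q; case: eqVneq => [->|]; rewrite ?fp ?andbF.
Qed.

(** Distinct indices have disjoint fibres, so most relations hold summand by summand. The four-term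
    relation and the two relations on sums x_i + x_j and y_i + y_j need a whole fibre at once: one
    fibre if [i = j], the union of two otherwise. *)
Lemma tf_pull_rel s u : tf_rel s u -> leval tf_pull s = leval tf_pull u.
Proof.
have fneq p q i j : f p == i -> f q == j -> i != j -> p != q.
  by move=> /eqP <- /eqP <-; apply: contraNneq => ->.
case=> {s u}.
- move=> i j; rewrite /= exchange_big; apply: eq_bigr => p _.
  by apply: eq_bigr => q _; rewrite tf_tC.
- move=> i j k l ik il jk jl /=; rewrite br_suml big1 // => p fp.
  rewrite br_suml big1 // => q fq; rewrite br_sumr big1 // => r fr.
  by rewrite br_sumr big1 // => o fo; apply: tf_tt; eauto.
- move=> i j k ki kj /=; rewrite br_suml big1 // => p fp.
  rewrite br_suml big1 // => q fq.
  rewrite exchange_big [X in _ + X]exchange_big /= -big_split br_sumr.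
  apply: big1 => r fr /=; move: fq kj; have [<-|ij] := eqVneq i j => fq kj.
    rewrite brDr (tf_4T_sum (A := fun p => f p == i)) ?addr0 //.
    by rewrite (eqP fr).
  rewrite fibreU //.
  rewrite (tf_4T_sum (A := fun p => (f p == i) || (f p == j))) ?fp ?fq ?orbT //.
  by rewrite (eqP fr) negb_or ki.
- move=> i j a b ij /=; transitivity
    (\sum_(p | f p == i) \sum_(q | f q == j) if a == b then t p q else 0).
    rewrite br_suml; apply: eq_bigr => p fp; rewrite br_sumr.
    by apply: eq_bigr => q fq; rewrite tf_xy; eauto.
  by case: eqP => // _ /=; rewrite big1 // => p _; rewrite big1.
- move=> i j a b ij /=; rewrite br_suml big1 // => p fp.
  by rewrite br_sumr big1 // => q fq; apply: tf_xx; eauto.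
- move=> i j a b ij /=; rewrite br_suml big1 // => p fp.
  by rewrite br_sumr big1 // => q fq; apply: tf_yy; eauto.
- move=> i j k a ki kj /=; rewrite br_suml big1 // => r fr.
  rewrite br_sumr big1 // => p fp; rewrite br_sumr big1 // => q fq.
  by apply: tf_xt; eauto.
- move=> i j k a ki kj /=; rewrite br_suml big1 // => r fr.
  rewrite br_sumr big1 // => p fp; rewrite br_sumr big1 // => q fq.
  by apply: tf_yt; eauto.
- move=> i j a /=; rewrite br_sumr big1 // => p fp.
  rewrite br_sumr big1 // => q; have [<-|ij] := eqVneq i j => fq.
    by rewrite brDl (tf_xxt_sum (A := fun p => f p == i)) ?addr0.
  rewrite fibreU // (tf_xxt_sum (A := fun p => (f p == i) || (f p == j))) //.
    by rewrite fp.
  by rewrite fq orbT.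
- move=> i j a /=; rewrite br_sumr big1 // => p fp.
  rewrite br_sumr big1 // => q; have [<-|ij] := eqVneq i j => fq.
    by rewrite brDl (tf_yyt_sum (A := fun p => f p == i)) ?addr0.
  rewrite fibreU // (tf_yyt_sum (A := fun p => (f p == i) || (f p == j))) //.
    by rewrite fp.
  by rewrite fq orbT.
- by move=> i; rewrite leval_tf_diag tf_pull_diag.
Qed.

End Pullback.

End TfTheory.

Lemma tf_tii_central K g (I : finType) (L : lieAlgType K) (gen : tgen g I -> L)
  :
  [pchar K] =i pred0 -> is_tf gen -> forall i v, {[gen (Tg g i i), v]} = 0.
Proof.
move=> char0 HL i v.
apply: (presented_ind HL (S := fun v => {[gen (Tg g i i), v]} = 0)) => {v}.
- exact: br0r.
- by move=> a v w v0 w0; rewrite brDr brZr v0 w0 scaler0 addr0.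
- by move=> v w v0 w0; rewrite br_brr v0 w0 br0l br0r addr0.
- by apply: tf_tii_gen => //; exact: HL.1.
Qed.

Lemma big_option (V : nmodType) (I : finType) (P : pred (option I))
  (F : option I -> V) :
  \sum_(j | P j) F j = (if P None then F None else 0) + \sum_(i | P (Some i)) F
    (Some i).
Proof.
have -> : index_enum (option I) = None :: [seq Some i | i <- index_enum I].
  by rewrite ![index_enum _]unlock [in LHS]unlock.
by rewrite big_cons big_map; case: ifP; rewrite ?add0r.
Qed.

(** * The holomorph of a Lie algebra *)

Section DerivationValues.
Variables (K : fieldType) (L : lieAlgType K).
Implicit Types d e : lie_Der L.

Lemma der_val_br d e v :
  der_val {[d, e]} v = der_val d (der_val e v) - der_val e (der_val d v).
Proof. by []. Qed.
Lemma der_valD d e v : der_val (d + e) v = der_val d v + der_val e v.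
Proof. by []. Qed.
Lemma der_valN d v : der_val (- d) v = - der_val d v.
Proof. by []. Qed.
Lemma der_val0 v : der_val (0 : lie_Der L) v = 0.
Proof. by []. Qed.
Lemma der_val_sum I r (P : pred I) (F : I -> lie_Der L) v :
  der_val (\sum_(i <- r | P i) F i) v = \sum_(i <- r | P i) der_val (F i) v.
Proof. exact: (big_morph (fun d : lie_Der L => der_val d v)). Qed.

Lemma der_val_ad (v w : L) : der_val (ad v) w = {[v, w]}.
Proof. by []. Qed.

Lemma comm_ad d v : {[d, ad v]} = ad (der_val d v).
Proof. by apply: der_eqP => w; rewrite der_val_br /= der_br; zmod. Qed.

(* The holomorph of [L]. *)
Definition lie_hol : lieAlgType K.
Proof.
apply: (@lie_sdir K L (lie_Der L) (@der_val K L)) => //.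
- by move=> a d v w; exact: derP.
- by move=> d v w; exact: der_br.
Defined.

Lemma hol_br (p q : lie_hol) :
  {[p, q]} = ({[p.1, q.1]} + (der_val p.2 q.1 - der_val q.2 p.1), {[p.2, q.2]}).
Proof. by []. Qed.

(* [L] embeds in its holomorph as the right translations, with the second
   component recording the adjoint action. *)
Definition right_tr (v : L) : lie_hol := (- v, ad v).

Lemma right_tr_hom : lie_hom right_tr.
Proof.
split=> [a v w|v w]; rewrite /right_tr.
  by rewrite (lie_homP (@ad_hom _ _)); congr pair; rewrite /= scalerN; zmod.
rewrite hol_br -(lie_hom_br (@ad_hom _ _)); congr pair => /=.
by rewrite !(brNl, brNr) [{[w, v]}]brC; zmod.
Qed.

(** The contributions of [p.1] cancel: right translations form an ideal on which [p] acts through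
    its derivation component alone. *)
Lemma br_right_tr (p : lie_hol) v : {[p, right_tr v]} =
  right_tr (der_val p.2 v).
Proof.
rewrite hol_br comm_ad; congr pair => /=.
by rewrite !linearN /= [{[v, _]}]brC; zmod.
Qed.

End DerivationValues.

(** * Homomorphisms and derivations of u = L(H) + K t_** *)

Section FreeTimesLine.
Variables (K : fieldType) (X : Type) (LH : lieAlgType K) (hgen : X -> LH).
Hypothesis HLH : is_free_lie hgen.
Local Notation u := (uf LH).

Definition uf_gen (h : X) : u := (hgen h, 0).
Definition uf_c : u := (0, 1).

Lemma uf_inl_hom : lie_hom (fun v : LH => (v, 0) : u).
Proof.
by split=> [a x y|x y]; apply: injective_projections;
  rewrite /= ?scaler0 ?addr0.
Qed.

Lemma uf_decomp (v : u) : v = v.2 *: uf_c + (v.1, 0).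
Proof.
case: v => v a; congr pair; rewrite /= ?scaler0 ?add0r ?addr0 //.
by rewrite /GRing.scale /= mulr1.
Qed.

Lemma uf_c_central v : {[uf_c, v]} = 0.
Proof. by congr pair; rewrite br0l. Qed.

Lemma uf_hom_ext (M : lieAlgType K) (f h : u -> M) : lie_hom f -> lie_hom h ->
  (forall x, f (uf_gen x) = h (uf_gen x)) -> f uf_c = h uf_c -> f =1 h.
Proof.
move=> hf hh fh fhc v; rewrite [v]uf_decomp (lie_homP hf) (lie_homP hh) fhc.
congr (_ + _).
exact: (presented_ext HLH (lie_hom_comp hf uf_inl_hom)
  (lie_hom_comp hh uf_inl_hom)).
Qed.

Lemma uf_der_ext (d e : lie_Der u) :
  (forall x, der_val d (uf_gen x) = der_val e (uf_gen x)) ->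
  der_val d uf_c = der_val e uf_c -> d = e.
Proof.
move=> de dec; apply: der_eqP => v; rewrite [v]uf_decomp !derP dec.
congr (_ + _); move: v.1; apply: (free_der_ext HLH uf_inl_hom) => //.
  split=> [a x y|x y]; first by rewrite (lie_homP uf_inl_hom) derP.
  by rewrite (lie_hom_br uf_inl_hom) der_br.
split=> [a x y|x y]; first by rewrite (lie_homP uf_inl_hom) derP.
by rewrite (lie_hom_br uf_inl_hom) der_br.
Qed.

Lemma uf_der (d0 : X -> u) : exists d : lie_Der u,
  (forall x, der_val d (uf_gen x) = d0 x) /\ der_val d uf_c = 0.
Proof.
have [d [hd dE]] := free_der HLH uf_inl_hom d0.
have hd' : (fun v : u => d v.1) \in @in_der K u.
  apply/asboolP; split=> [a x y|x y]; first exact: hd.1.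
  (* The bracket on the line is constantly 0, so replacing [y] by [(y.1, 0)] inside a bracket is
     invisible up to conversion. *)
  by rewrite [LHS]hd.2.
exists (Der_sort hd'); split=> //=.
(* The value at [uf_c] is [d 0], which vanishes by additivity. *)
have := hd.1 1 0 0; rewrite !scale1r addr0 -[LHS]addr0 => /addrI.
exact: esym.
Qed.

End FreeTimesLine.

Local Arguments lie_br : simpl never.
Local Arguments der_val : simpl never.

(** * The strands other than [*] acting on u by derivations *)

Section StrandAction.
Variables (K : fieldType) (g n : nat).
Variables (LH : lieAlgType K) (hgen : ugen g n -> LH).
Hypothesis HLH : is_free_lie hgen.
Local Notation u := (uf LH).
Local Notation c := (uf_c LH).

Definition xi a : u := uf_gen hgen (UX n a).
Definition eta a : u := uf_gen hgen (UY n a).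
(* The element of [u] corresponding to [t_{j*}]; for [j = 0] it is determined by
   the last relation at the index [*]. It is locked because rewriting with
   linearity would otherwise see through [tau None]. *)
Definition tau (j : idx0 n) : u := locked
  match j with
  | Some k => uf_gen hgen (UT g k)
  | None =>
    (g%:R - 1) *: c - \sum_a {[xi a, eta a]} - \sum_k uf_gen hgen (UT g k)
  end.

Lemma tauS k : tau (Some k) = uf_gen hgen (UT g k).
Proof. by rewrite /tau -lock. Qed.
Lemma tau0 : tau None =
  (g%:R - 1) *: c - \sum_a {[xi a, eta a]} - \sum_k uf_gen hgen (UT g k).
Proof. by rewrite /tau -lock. Qed.

Lemma tau_sum : \sum_a {[xi a, eta a]} + \sum_j tau j = (g%:R - 1) *: c.
Proof.
by rewrite big_option /= tau0 (eq_bigr _ (fun k _ => tauS k)); zmod.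
Qed.

(* The adjoint action on [u] of the generators of [t^f] not involving [*]. *)
Definition adj_gen (z : tgen g (idx0 n)) (h : ugen g n) : u :=
  match z, h with
  | Xg a i, UY b => if a == b then tau i else 0
  | Xg a i, UT k => if Some k == i then {[tau i, xi a]} else 0
  | Yg a i, UX b => if a == b then - tau i else 0
  | Yg a i, UT k => if Some k == i then {[tau i, eta a]} else 0
  | Tg i j, UT k => (if Some k == i then {[tau i, tau j]} else 0)
                    + (if Some k == j then {[tau j, tau i]} else 0)
  | _, _ => 0
  end.

Lemma adj_exists : exists E : tgen g (idx0 n) -> lie_Der u, forall z,
  (forall h, der_val (E z) (uf_gen hgen h) = adj_gen z h) /\ der_val (E z) c =
    0.
Proof.
by have [E HE] := boolp.choice (fun z => uf_der HLH (adj_gen z)); exists E.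
Qed.

Variable E : tgen g (idx0 n) -> lie_Der u.
Hypothesis HE : forall z,
  (forall h, der_val (E z) (uf_gen hgen h) = adj_gen z h) /\ der_val (E z) c =
    0.

Local Notation Et i j := (der_val (E (Tg g i j))).
Local Notation Ex a i := (der_val (E (Xg a i))).
Local Notation Ey a i := (der_val (E (Yg a i))).

Lemma adj_c z : der_val (E z) c = 0. Proof. exact: (HE z).2. Qed.
Lemma Et_xi i j a : Et i j (xi a) = 0. Proof. exact: (HE _).1. Qed.
Lemma Et_eta i j a : Et i j (eta a) = 0. Proof. exact: (HE _).1. Qed.
Lemma Ex_xi a i b : Ex a i (xi b) = 0. Proof. exact: (HE _).1. Qed.
Lemma Ex_eta a i b : Ex a i (eta b) = if a == b then tau i else 0.
Proof. exact: (HE _).1. Qed.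
Lemma Ey_xi a i b : Ey a i (xi b) = if a == b then - tau i else 0.
Proof. exact: (HE _).1. Qed.
Lemma Ey_eta a i b : Ey a i (eta b) = 0. Proof. exact: (HE _).1. Qed.

Lemma sum_at_strand (v : u) (i : idx0 n) :
  \sum_k (if Some k == i then v else 0) = if i is Some _ then v else 0.
Proof.
rewrite -big_mkcond; case: i => [i|]; last by rewrite big_pred0.
by rewrite (eq_bigl (pred1 i)) ?big_pred1_eq.
Qed.

Lemma adj_tau0 z : der_val (E z) (tau None) =
  - (\sum_a ({[der_val (E z) (xi a), eta a]} + {[xi a, der_val (E z) (eta a)]})
     + \sum_k adj_gen z (UT g k)).
Proof.
rewrite tau0 !linearB linearZ /= adj_c scaler0 !(linear_sum (der_val (E z))) /=.
have -> : \sum_a der_val (E z) {[xi a, eta a]} =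
    \sum_a ({[der_val (E z) (xi a), eta a]} + {[xi a, der_val (E z) (eta a)]}).
  by apply: eq_bigr => a _; exact: der_br.
have -> : \sum_k der_val (E z) (uf_gen hgen (UT g k)) =
  \sum_k adj_gen z (UT g k).
  by apply: eq_bigr => k _; exact: (HE z).1.
by zmod.
Qed.

(** The formula prescribed at the points 1, ..., n persists at 0, where the value is forced by the
    definition of [tau None]. Together with its analogues for x and y this puts all points on the
    same footing. *)
Lemma Et_tau i j k : Et i j (tau k) =
  (if k == i then {[tau i, tau j]} else 0) +
    (if k == j then {[tau j, tau i]} else 0).
Proof.
case: k => [k|]; first by rewrite tauS (HE _).1.
rewrite adj_tau0 big1 => [|a _]; last by rewrite Et_xi Et_eta br0l br0r addr0.
rewrite add0r big_split !sum_at_strand.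
by rewrite [{[tau j, tau i]}]brC; case: i j => [i|] [j|]; rewrite ?eqxx /=;
  zmod.
Qed.

(** At the point 0 the sum of brackets reduces to [xi a, tau i]. It cancels the value at [tau i] if
    [i] is not 0, and is itself the required value, up to sign, if [i] is 0. *)
Lemma Ex_tau a i k : Ex a i (tau k) = if k == i then {[tau i, xi a]} else 0.
Proof.
case: k => [k|]; first by rewrite tauS (HE _).1.
rewrite adj_tau0 sum_at_strand (bigD1 a) //= big1 => [|b ba].
  by rewrite Ex_xi Ex_eta eqxx br0l; case: i => [i|] //=;
    rewrite [{[xi a, _]}]brC; zmod.
by rewrite Ex_xi Ex_eta eq_sym (negPf ba) br0l br0r addr0.
Qed.

Lemma Ey_tau a i k : Ey a i (tau k) = if k == i then {[tau i, eta a]} else 0.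
Proof.
case: k => [k|]; first by rewrite tauS (HE _).1.
rewrite adj_tau0 sum_at_strand (bigD1 a) //= big1 => [|b ba].
  by rewrite Ey_xi Ey_eta eqxx br0r brNl; case: i => [i|] //=; zmod.
by rewrite Ey_xi Ey_eta eq_sym (negPf ba) br0l br0r addr0.
Qed.

(** Testing on all [tau j] at once avoids separating the point 0 from the others. *)
Lemma der_strand_ext (d e : lie_Der u) :
  (forall a, der_val d (xi a) = der_val e (xi a)) ->
  (forall a, der_val d (eta a) = der_val e (eta a)) ->
  (forall j, der_val d (tau j) = der_val e (tau j)) ->
  der_val d c = der_val e c -> d = e.
Proof.
move=> dex dey det; apply: (uf_der_ext HLH).
by case=> [k|a|a]; [have := det (Some k); rewrite tauS|exact: dex|exact: dey].
Qed.

Lemma Et_other i j k : k != i -> k != j -> Et i j (tau k) = 0.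
Proof. by move=> ki kj; rewrite Et_tau (negPf ki) (negPf kj) addr0. Qed.
Lemma Et_l i j : Et i j (tau i) = {[tau i, tau j]}.
Proof. by rewrite Et_tau eqxx; case: eqVneq => [->|];
  rewrite ?lie_brxx addr0. Qed.
Lemma Et_r i j : Et i j (tau j) = {[tau j, tau i]}.
Proof. by rewrite Et_tau eqxx; case: eqVneq => [->|];
  rewrite ?lie_brxx add0r. Qed.
Lemma Ex_same a i : Ex a i (tau i) = {[tau i, xi a]}.
Proof. by rewrite Ex_tau eqxx. Qed.
Lemma Ey_same a i : Ey a i (tau i) = {[tau i, eta a]}.
Proof. by rewrite Ey_tau eqxx. Qed.
Lemma Ex_other a i k : k != i -> Ex a i (tau k) = 0.
Proof. by move=> ki; rewrite Ex_tau (negPf ki). Qed.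
Lemma Ey_other a i k : k != i -> Ey a i (tau k) = 0.
Proof. by move=> ki; rewrite Ey_tau (negPf ki). Qed.

(** From here to [adj_yyt], the derivations [E z] are shown to satisfy the relations of t^f other
    than the diagonal one, by evaluation on [xi], [eta], [tau] and [c]. *)
Lemma adj_sym i j : E (Tg g i j) = E (Tg g j i).
Proof.
apply: der_strand_ext => [a|a|k|]; rewrite ?Et_xi ?Et_eta ?adj_c //.
by rewrite !Et_tau addrC.
Qed.

Lemma adj_tii i : E (Tg g i i) = 0.
Proof.
apply: der_strand_ext => [a|a|k|]; rewrite ?Et_xi ?Et_eta ?adj_c //.
by rewrite der_val0 Et_tau lie_brxx; case: ifP; rewrite addr0.
Qed.

Lemma adj_tt i j k l : i != k -> i != l -> j != k -> j != l ->
  {[E (Tg g i j), E (Tg g k l)]} = 0.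
Proof.
move=> ik il jk jl; have [ki li kj lj] : [/\ k != i, l != i, k != j & l != j].
  by rewrite ![_ == i]eq_sym ![_ == j]eq_sym.
apply: der_strand_ext => [a|a|m|];
  rewrite der_val_br ?der_val0 ?Et_xi ?Et_eta ?adj_c
  ?(addr0, oppr0, linear0, subrr) //.
rewrite (Et_tau k l) (Et_tau i j m) !linearD /= !(fun_if (der_val _)) !linear0.
rewrite !der_br !Et_other // !br0l !br0r !addr0.
by rewrite !(if_same, addr0, oppr0).
Qed.

Lemma adj_4T i j k : k != i -> k != j ->
  {[E (Tg g i j), E (Tg g i k) + E (Tg g j k)]} = 0.
Proof.
move=> ki kj; have [ik jk] : i != k /\ j != k by rewrite ![_ == k]eq_sym.
have [<-|ij] := eqVneq i j; first by rewrite adj_tii br0l.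
have ji : j != i by rewrite eq_sym.
apply: der_strand_ext => [a|a|m|];
  rewrite der_val_br !der_valD ?der_val0 ?Et_xi ?Et_eta ?adj_c;
  rewrite ?(addr0, oppr0, linear0) //.
(* At [tau i] and [tau j] the identity is the Jacobi identity for the three elements [tau i],
   [tau j], [tau k]; at [tau k] two opposite brackets cancel. *)
have [->|mi] := eqVneq m i.
  rewrite (Et_other (i := j)) // addr0 !Et_l !der_br !(Et_l, Et_r)
    (Et_other (i := i)) //.
  rewrite (Et_other (i := j) (j := k)) // (Et_other (i := i) (j := k)) //.
  by rewrite !(br0l, br0r) [{[tau i, {[tau j, _]}]}]br_brr
    [{[_, {[tau i, tau k]}]}]brC; zmod.
have [->|mj] := eqVneq m j.
  rewrite (Et_other (i := i) (j := k)) //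
    add0r Et_l Et_r !der_br !(Et_l, Et_r) (Et_other (i := i) (j := j)) //.
  rewrite (Et_other (i := j) (j := k)) // (Et_other (i := i) (j := k)) //.
  by rewrite !(br0l, br0r) [{[tau j, {[tau i, _]}]}]br_brr
    [{[_, {[tau j, tau k]}]}]brC; zmod.
have [->|mk] := eqVneq m k; last by rewrite !Et_other //
  ?(addr0, oppr0, linear0, subrr).
rewrite !Et_r (Et_other (i := i) (j := j)) //
  linear0 linear0 linearD /= !der_br.
rewrite (Et_other (k := k)) // Et_l Et_r !br0l [{[tau j, tau i]}]brC brNr.
by zmod.
Qed.

Lemma adj_xy i j a b : i != j ->
  {[E (Xg a i), E (Yg b j)]} = if a == b then E (Tg g i j) else 0.
Proof.
move=> ij; have ji : j != i by rewrite eq_sym.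
have ifE v : der_val (if a == b then E (Tg g i j) else 0) v =
  if a == b then Et i j v else 0.
  by case: eqP.
apply: der_strand_ext => [d|d|m|]; rewrite der_val_br ifE ?Et_xi ?Et_eta ?adj_c.
- by rewrite Ey_xi Ex_xi (fun_if (der_val _)) linearN /= Ex_other //
  ?(if_same, addr0, oppr0, linear0, subrr).
- by rewrite Ey_eta Ex_eta (fun_if (der_val _)) Ey_other //
  ?(if_same, addr0, oppr0, linear0, subrr).
- have [->|mi] := eqVneq m i.
    rewrite Ey_other // linear0 Ex_same der_br Ey_other //
      br0l add0r Ey_xi eq_sym Et_l.
    by case: eqP => _; rewrite ?brNr ?br0r; zmod.
  have [->|mj] := eqVneq m j.
    rewrite Ex_other // linear0 Ey_same der_br Ex_other //
      br0l add0r Ex_eta Et_r.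
    by case: eqP => _; rewrite ?brNr ?br0r; zmod.
  by rewrite Ex_other // Ey_other // !linear0 Et_other //
    ?(if_same, addr0, oppr0, linear0, subrr).
- by rewrite ?(addr0, oppr0, linear0, subrr) if_same.
Qed.

Lemma adj_xx i j a b : i != j -> {[E (Xg a i), E (Xg b j)]} = 0.
Proof.
move=> ij; have ji : j != i by rewrite eq_sym.
apply: der_strand_ext => [d|d|m|];
  rewrite der_val_br ?der_val0 ?Ex_xi ?adj_c ?(addr0, oppr0, linear0, subrr) //.
  by rewrite !Ex_eta !(fun_if (der_val _)) !Ex_other //
    ?(if_same, addr0, oppr0, linear0, subrr).
have [->|mi] := eqVneq m i.
  by rewrite (Ex_other b) // linear0 Ex_same der_br Ex_other // Ex_xi br0l br0r;
    zmod.
have [->|mj] := eqVneq m j.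
  by rewrite (Ex_other a) // linear0 Ex_same der_br Ex_other // Ex_xi br0l br0r;
    zmod.
by rewrite !Ex_other // ?(addr0, oppr0, linear0, subrr).
Qed.

Lemma adj_yy i j a b : i != j -> {[E (Yg a i), E (Yg b j)]} = 0.
Proof.
move=> ij; have ji : j != i by rewrite eq_sym.
apply: der_strand_ext => [d|d|m|];
  rewrite der_val_br ?der_val0 ?Ey_eta ?adj_c
  ?(addr0, oppr0, linear0, subrr) //.
  by rewrite !Ey_xi !(fun_if (der_val _)) ?linear0 !linearN /= !Ey_other //
    ?(if_same, addr0, oppr0, linear0, subrr).
have [->|mi] := eqVneq m i.
  by rewrite (Ey_other b) // linear0 Ey_same der_br Ey_other //
    Ey_eta br0l br0r; zmod.
have [->|mj] := eqVneq m j.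
  by rewrite (Ey_other a) // linear0 Ey_same der_br Ey_other //
    Ey_eta br0l br0r; zmod.
by rewrite !Ey_other // ?(addr0, oppr0, linear0, subrr).
Qed.

Lemma adj_xt i j k a : k != i -> k != j -> {[E (Xg a k), E (Tg g i j)]} = 0.
Proof.
move=> ki kj; have [ik jk] : i != k /\ j != k by rewrite ![_ == k]eq_sym.
apply: der_strand_ext => [d|d|m|];
  rewrite der_val_br ?der_val0 ?Ex_xi ?Et_xi ?Et_eta ?adj_c
  ?(addr0, oppr0, linear0, subrr) //.
  by rewrite Ex_eta (fun_if (der_val _)) Et_other //
    ?(if_same, addr0, oppr0, linear0, subrr).
rewrite Et_tau Ex_tau linearD /= !(fun_if (der_val _)) ?linear0 !der_br.
by rewrite !Ex_other // Et_other //
  Et_xi !br0l !br0r !addr0 ?(if_same, addr0, oppr0, linear0, subrr).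
Qed.

Lemma adj_yt i j k a : k != i -> k != j -> {[E (Yg a k), E (Tg g i j)]} = 0.
Proof.
move=> ki kj; have [ik jk] : i != k /\ j != k by rewrite ![_ == k]eq_sym.
apply: der_strand_ext => [d|d|m|];
  rewrite der_val_br ?der_val0 ?Ey_eta ?Et_xi ?Et_eta ?adj_c
  ?(addr0, oppr0, linear0, subrr) //.
  by rewrite Ey_xi (fun_if (der_val _)) linearN /= Et_other //
    ?(if_same, addr0, oppr0, linear0, subrr).
rewrite Et_tau Ey_tau linearD /= !(fun_if (der_val _)) ?linear0 !der_br.
by rewrite !Ey_other // Et_other //
  Et_eta !br0l !br0r !addr0 ?(if_same, addr0, oppr0, linear0, subrr).
Qed.

Lemma adj_xxt i j a : {[E (Xg a i) + E (Xg a j), E (Tg g i j)]} = 0.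
Proof.
have [<-|ij] := eqVneq i j; first by rewrite adj_tii br0r.
have ji : j != i by rewrite eq_sym.
apply: der_strand_ext => [d|d|m|];
  rewrite der_val_br !der_valD ?der_val0 ?Ex_xi ?Et_xi ?Et_eta ?adj_c
  ?(addr0, oppr0, linear0, subrr) //.
  rewrite !Ex_eta linearD /= !(fun_if (der_val _)) ?linear0 Et_l Et_r
    [{[tau j, _]}]brC.
  by case: eqP => _; zmod.
have [->|mi] := eqVneq m i.
  rewrite (Ex_other a (i := j)) //
    addr0 Et_l Ex_same !der_br Et_l Et_xi !Ex_same !Ex_other //.
  by rewrite !(br0l, br0r) [{[{[tau i, tau j]}, _]}]br_brl
    [{[{[_, xi a]}, _]}]brC; zmod.
have [->|mj] := eqVneq m j.
  rewrite (Ex_other a (i := i)) //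
    add0r Et_r Ex_same !der_br Et_r Et_xi !Ex_same !Ex_other //.
  by rewrite !(br0l, br0r) [{[{[tau j, tau i]}, _]}]br_brl
    [{[{[_, xi a]}, _]}]brC; zmod.
by rewrite !Ex_other // Et_other // ?(addr0, oppr0, linear0, subrr).
Qed.

Lemma adj_yyt i j a : {[E (Yg a i) + E (Yg a j), E (Tg g i j)]} = 0.
Proof.
have [<-|ij] := eqVneq i j; first by rewrite adj_tii br0r.
have ji : j != i by rewrite eq_sym.
apply: der_strand_ext => [d|d|m|];
  rewrite der_val_br !der_valD ?der_val0 ?Ey_eta ?Et_xi ?Et_eta ?adj_c
  ?(addr0, oppr0, linear0, subrr) //.
  rewrite !Ey_xi linearD /= !(fun_if (der_val _)) ?linear0 !linearN /= Et_l Et_r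
    [{[tau j, _]}]brC.
  by case: eqP => _; zmod.
have [->|mi] := eqVneq m i.
  rewrite (Ey_other a (i := j)) //
    addr0 Et_l Ey_same !der_br Et_l Et_eta !Ey_same !Ey_other //.
  by rewrite !(br0l, br0r) [{[{[tau i, tau j]}, _]}]br_brl
    [{[{[_, eta a]}, _]}]brC; zmod.
have [->|mj] := eqVneq m j.
  rewrite (Ey_other a (i := i)) //
    add0r Et_r Ey_same !der_br Et_r Et_eta !Ey_same !Ey_other //.
  by rewrite !(br0l, br0r) [{[{[tau j, tau i]}, _]}]br_brl
    [{[{[_, eta a]}, _]}]brC; zmod.
by rewrite !Ey_other // Et_other // ?(addr0, oppr0, linear0, subrr).
Qed.

(** In the larger algebra the relation at [i] has one more summand t_{i*}, acting as [ad (tau i)]: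
    this is the defect on the right, while t_ii acts as 0. On [tau i] the identity follows from
    [tau_sum] and the centrality of [c]; on the other [tau m], and on each [xi] and [eta], a single
    term survives. *)
Lemma adj_diag i :
  \sum_a {[E (Xg a i), E (Yg a i)]} + \sum_(j | j != i) E (Tg g i j) =
    - ad (tau i).
Proof.
apply: der_strand_ext => [b|b|m|];
  rewrite der_valD der_valN !der_val_sum der_val_ad.
- rewrite (bigD1 b) //= big1 => [|a ab]; last first.
    by rewrite der_val_br Ex_xi Ey_xi (negPf ab)
      ?(addr0, oppr0, linear0, subrr).
  rewrite big1 => [|j _]; last exact: Et_xi.
  by rewrite der_val_br Ex_xi Ey_xi eqxx linear0 linearN /= Ex_same; zmod.
- rewrite (bigD1 b) //= big1 => [|a ab]; last first.
    by rewrite der_val_br Ex_eta Ey_eta (negPf ab)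
      ?(addr0, oppr0, linear0, subrr).
  rewrite big1 => [|j _]; last exact: Et_eta.
  by rewrite der_val_br Ex_eta Ey_eta eqxx linear0 Ey_same; zmod.
- have [->|mi] := eqVneq m i.
    have -> : \sum_a der_val {[E (Xg a i), E (Yg a i)]} (tau i) =
        \sum_a {[tau i, {[xi a, eta a]}]}.
      apply: eq_bigr => a _; rewrite der_val_br Ex_same Ey_same !der_br.
      rewrite Ex_same Ey_same Ex_eta Ey_xi eqxx brNr !lie_brxx.
      by rewrite [RHS]br_brr [{[xi a, _]}]brC; zmod.
    rewrite (eq_bigr (fun j => {[tau i, tau j]})) => [|j _]; last exact: Et_l.
    rewrite -!br_sumr -brDr; have := tau_sum; rewrite (bigD1 i) //= => e.
    have -> : \sum_a {[xi a, eta a]} + \sum_(j | j != i) tau j =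
      (g%:R - 1) *: c - tau i.
      by rewrite -e; zmod.
    by rewrite brBr brZr [{[_, c]}]brC uf_c_central oppr0 scaler0 lie_brxx;
      zmod.
  rewrite big1 => [|a _]; last by rewrite der_val_br Ex_other // Ey_other //
    ?(addr0, oppr0, linear0, subrr).
  rewrite (bigD1 m) //= big1 => [|j /andP[ji jm]]; last by rewrite Et_other //
    eq_sym.
  by rewrite Et_r [{[tau m, _]}]brC; zmod.
- rewrite !big1 => [|j _|a _]; rewrite ?adj_c ?der_val_br ?adj_c
  ?(addr0, oppr0, linear0, subrr) //.
  by rewrite brC uf_c_central; zmod.
Qed.

(** * The homomorphism from t^f to the holomorph of u *)

(* The difference between the section and the inclusion of the strands other
   than [*]: only the strand [0] is doubled. *)
Definition twist (z : tgen g (idx0 n)) : u :=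
  match z with
  | Tg None None => tau None + tau None + c
  | Tg (Some i) None | Tg None (Some i) => tau (Some i)
  | Xg a None => xi a
  | Yg a None => eta a
  | _ => 0
  end.

Let zE := (addr0, add0r, oppr0, br0l, br0r).

Definition hol_strand z : lie_hol u := (twist z, E z).

Local Notation T i j := (hol_strand (Tg g i j)).
Local Notation X a i := (hol_strand (Xg a i)).
Local Notation Y a i := (hol_strand (Yg a i)).

(** In this and the next [hol_] lemmas the second component is the matching [adj_] lemma. For the
    relations between brackets, the first component is a non-abelian cocycle condition on
    [twist]. *)
Lemma hol_sym i j : T i j = T j i.
Proof. by congr pair; [case: i j => [i|] [j|]|exact: adj_sym]. Qed.

Lemma hol_tt i j k l : i != k -> i != l -> j != k -> j != l ->
  {[T i j, T k l]} = 0.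
Proof.
move=> ik il jk jl; have [ki li kj lj] : [/\ k != i, l != i, k != j & l != j].
  by rewrite ![_ == i]eq_sym ![_ == j]eq_sym.
rewrite hol_br adj_tt //; congr pair.
(* Every [twist (Tg g r s)] is a combination of [tau r], [tau s] and [c], all killed by t_pq when
   the indices are disjoint. *)
have kill p q r s : r != p -> r != q -> s != p -> s != q ->
    der_val (E (Tg g p q)) (twist (Tg g r s)) = 0.
  move=> rp rq sp sq; have [er es] := (Et_other rp rq, Et_other sp sq).
  by move: er es; case: r s {rp rq sp sq} => [r|] [s|] er es /=;
     rewrite ?linearD /= ?er ?es ?adj_c ?linear0 ?addr0 //.
rewrite !kill // subrr addr0.
(* Both twists can be nonzero only if 0 occurs in both pairs, which disjointness excludes. *)
by move: ik il jk jl {ki li kj lj}; case: i j k l => [i|] [j|] [k|] [l|];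
  rewrite ?eqxx //= ?br0l ?br0r.
Qed.

Lemma hol_4T i j k : k != i -> k != j -> {[T i j, T i k + T j k]} = 0.
Proof.
move=> ki kj; have [ik jk] : i != k /\ j != k by rewrite ![_ == k]eq_sym.
rewrite hol_br adj_4T //; congr pair; rewrite /= der_valD; move: ki kj ik jk.
case: i j k => [i|] [j|] [k|] //= ki kj ik jk; rewrite ?addr0 ?add0r.
- by rewrite !br0l !linear0 !zE.
- by rewrite !br0l !linear0 !zE linearD /= Et_l Et_r [{[tau (Some j), _]}]brC;
  zmod.
- by rewrite Et_other // Et_l (Et_other (i := None)) //; zmod.
- by rewrite !(Et_other (i := None)) // Et_l; zmod.
rewrite adj_tii der_val0 !linearD /= adj_c Et_l.
by rewrite !(brDl, brDr) !uf_c_central; zmod.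
Qed.

Lemma hol_xy i j a b : i != j -> {[X a i, Y b j]} = if a == b then T i j else 0.
Proof.
move=> ij; rewrite hol_br adj_xy //.
transitivity ((if a == b then twist (Tg g i j) else 0,
               if a == b then E (Tg g i j) else 0) : lie_hol u);
                 last by case: eqP.
congr pair; case: i j ij => [i|] [j|] //= _.
- by rewrite !linear0 !zE if_same.
- by rewrite !linear0 Ex_eta !zE.
- by rewrite !linear0 Ey_xi [b == a]eq_sym !zE; case: (a == b);
  rewrite ?opprK ?oppr0.
Qed.

Lemma hol_xx i j a b : i != j -> {[X a i, X b j]} = 0.
Proof.
move=> ij; rewrite hol_br adj_xx //; congr pair.
by case: i j ij => [i|] [j|] //= _; rewrite ?Ex_xi ?linear0 !zE.
Qed.

Lemma hol_yy i j a b : i != j -> {[Y a i, Y b j]} = 0.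
Proof.
move=> ij; rewrite hol_br adj_yy //; congr pair.
by case: i j ij => [i|] [j|] //= _; rewrite ?Ey_eta ?linear0 !zE.
Qed.

Lemma hol_xt i j k a : k != i -> k != j -> {[X a k, T i j]} = 0.
Proof.
move=> ki kj; have [ik jk] : i != k /\ j != k by rewrite ![_ == k]eq_sym.
rewrite hol_br adj_xt //; congr pair; move: ki kj ik jk.
case: i j k => [i|] [j|] [k|] //= ki kj ik jk;
  rewrite ?Et_xi ?linearD /= ?Ex_other ?adj_c ?linear0 ?zE //.
Qed.

Lemma hol_yt i j k a : k != i -> k != j -> {[Y a k, T i j]} = 0.
Proof.
move=> ki kj; have [ik jk] : i != k /\ j != k by rewrite ![_ == k]eq_sym.
rewrite hol_br adj_yt //; congr pair; move: ki kj ik jk.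
case: i j k => [i|] [j|] [k|] //= ki kj ik jk;
  rewrite ?Et_eta ?linearD /= ?Ey_other ?adj_c ?linear0 ?zE //.
Qed.

Lemma hol_xxt i j a : {[X a i + X a j, T i j]} = 0.
Proof.
rewrite hol_br adj_xxt //; congr pair; rewrite /= der_valD.
case: i j => [i|] [j|] /=; rewrite ?linearD /= ?Et_xi ?linear0 ?zE //.
- by rewrite Ex_same Ex_other // [{[xi a, _]}]brC; zmod.
- by rewrite Ex_same Ex_other // [{[xi a, _]}]brC; zmod.
rewrite Ex_same adj_c !(brDl, brDr) [{[xi a, c]}]brC uf_c_central.
by rewrite [{[xi a, _]}]brC; zmod.
Qed.

Lemma hol_yyt i j a : {[Y a i + Y a j, T i j]} = 0.
Proof.
rewrite hol_br adj_yyt //; congr pair; rewrite /= der_valD.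
case: i j => [i|] [j|] /=; rewrite ?linearD /= ?Et_eta ?linear0 ?zE //.
- by rewrite Ey_same Ey_other // [{[eta a, _]}]brC; zmod.
- by rewrite Ey_same Ey_other // [{[eta a, _]}]brC; zmod.
rewrite Ey_same adj_c !(brDl, brDr) [{[eta a, c]}]brC uf_c_central.
by rewrite [{[eta a, _]}]brC; zmod.
Qed.

Lemma hol_sum I r (P : pred I) (F : I -> lie_hol u) :
  \sum_(i <- r | P i) F i = (\sum_(i <- r | P i) (F i).1,
    \sum_(i <- r | P i) (F i).2).
Proof.
apply: injective_projections => /=.
  exact: (big_morph (fun p : lie_hol u => p.1)).
exact: (big_morph (fun p : lie_hol u => p.2)).
Qed.

(** The term [right_tr (tau i)] stands for t_{i*}, and its [ad (tau i)] cancels the defect in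
    [adj_diag]. In the first component, for [i] other than 0, its [- tau i] cancels the twist of
    t_{i0}. At 0 the sums over [a] give g [tau None] twice, and [tau_sum] yields (g - 1)(2
    [tau None] + [c]), which explains the value of [twist] at t_00. *)
Lemma hol_diag i : \sum_a {[X a i, Y a i]} + \sum_(j | j != i) T i j
  + right_tr (tau i) = (g%:R - 1) *: T i i.
Proof.
rewrite !hol_sum; apply: injective_projections => /=; last first.
  rewrite adj_tii scaler0.
  by rewrite [Z in Z + _]adj_diag addNr.
rewrite big_option; case: i => [i|] /=.
  rewrite big1 => [|a _]; last by rewrite br0l !linear0 !zE.
  by rewrite big1 // !zE subrr scaler0.
have e := tau_sum; rewrite big_option /= in e.
rewrite !big_split /=.
have -> : \sum_a Ex a None (eta a) = \sum_(a < g) tau None.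
  by apply: eq_bigr => a _; rewrite Ex_eta eqxx.
have -> : \sum_a - Ey a None (xi a) = \sum_(a < g) tau None.
  by apply: eq_bigr => a _; rewrite Ey_xi eqxx opprK.
rewrite !sumr_const !card_ord -!scaler_nat 2!scalerDr -e !scalerBl !scale1r.
by zmod.
Qed.

Definition hol_gen (z : tgen g (idxs0 n)) : lie_hol u :=
  match z with
  | Tg (Some i) (Some j) => T i j
  | Tg (Some i) None | Tg None (Some i) => right_tr (tau i)
  | Tg None None => right_tr c
  | Xg a (Some i) => X a i
  | Xg a None => right_tr (xi a)
  | Yg a (Some i) => Y a i
  | Yg a None => right_tr (eta a)
  end.

Local Notation rt := (@right_tr K u).

Lemma br_rtr p v : {[p, rt v]} = rt (der_val p.2 v).
Proof. exact: br_right_tr. Qed.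
Lemma br_rtl p v : {[rt v, p]} = rt (- der_val p.2 v).
Proof. by rewrite brC br_rtr (lie_homN (@right_tr_hom K u)). Qed.
Lemma rt0 : rt 0 = 0. Proof. exact: (lie_hom0 (@right_tr_hom K u)). Qed.
Lemma rtD v w : rt v + rt w = rt (v + w).
Proof. by rewrite (lie_homD (@right_tr_hom K u)). Qed.

(** Away from [*] this is [hol_diag]; at [*] it is the image of [tau_sum] under [right_tr]. *)
Lemma hol_gen_diag i :
  \sum_a {[hol_gen (Xg a i), hol_gen (Yg a i)]}
    + \sum_(j | j != i) hol_gen (Tg g i j) = (g%:R - 1) *: hol_gen (Tg g i i).
Proof.
have hrt := @right_tr_hom K u; rewrite big_option; case: i => [i|] /=.
  by rewrite -hol_diag; zmod.
rewrite add0r -(lie_homZ hrt) -tau_sum (lie_homD hrt) !(lie_hom_sum hrt).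
by congr (_ + _); apply: eq_bigr => a _; rewrite (lie_hom_br hrt).
Qed.

(** Relations without [*] are the [hol_] lemmas. A bracket with a generator on the strand [*] is by
    [br_rtr] or [br_rtl] the right translation by a value of a derivation, so these relations reduce
    to the formulas for [E] and [ad] on u. *)
Lemma hol_gen_rel s t : tf_rel s t -> leval hol_gen s = leval hol_gen t.
Proof.
case=> {s t}.
- by move=> [i|] [j|] //=; rewrite hol_sym.
- move=> [i|] [j|] [k|] [l|] //= ik il jk jl;
  rewrite ?br_rtr ?br_rtl /= ?Et_other ?adj_c ?oppr0 ?rt0 //.
  + exact: hol_tt.
  + by rewrite eq_sym.
  + by rewrite eq_sym.
  + by rewrite eq_sym.
  + by rewrite eq_sym.
- move=> [i|] [j|] [k|] //= ki kj; rewrite ?rtD ?brDr ?br_rtr ?br_rtl.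
  + by rewrite -brDr hol_4T.
  + by rewrite /= linearD /= Et_l Et_r [{[tau j, _]}]brC subrr rt0.
  + by rewrite rtD /= Et_l der_val_ad addNr rt0.
  + by rewrite rtD /= Et_l der_val_ad subrr rt0.
  + by rewrite /= der_val_ad uf_c_central rt0.
- move=> [i|] [j|] a b //= ij; rewrite ?br_rtr ?br_rtl /=.
  + by rewrite hol_xy //; case: eqP.
  + by rewrite Ex_eta; case: eqP => //=; rewrite rt0.
  + by rewrite Ey_xi eq_sym; case: eqP => /=; rewrite ?opprK ?oppr0 ?rt0.
- move=> [i|] [j|] a b //= ij; rewrite ?br_rtr ?br_rtl /= ?Ex_xi ?oppr0 ?rt0 //.
  exact: hol_xx.
- move=> [i|] [j|] a b //= ij; rewrite ?br_rtr ?br_rtl /= ?Ey_eta ?oppr0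
  ?rt0 //.
  exact: hol_yy.
- move=> [i|] [j|] [k|] a //= ki kj; rewrite ?br_rtr ?br_rtl /=.
  + exact: hol_xt.
  + by rewrite Et_xi oppr0 rt0.
  + by rewrite Ex_other ?rt0 // eq_sym.
  + by rewrite Ex_other ?rt0 // eq_sym.
  + by rewrite adj_c rt0.
- move=> [i|] [j|] [k|] a //= ki kj; rewrite ?br_rtr ?br_rtl /=.
  + exact: hol_yt.
  + by rewrite Et_eta oppr0 rt0.
  + by rewrite Ey_other ?rt0 // eq_sym.
  + by rewrite Ey_other ?rt0 // eq_sym.
  + by rewrite adj_c rt0.
- move=> [i|] [j|] a /=; first exact: hol_xxt.
  + by rewrite brDl !br_rtr /= Ex_same der_val_ad rtD brC addNr rt0.
  + by rewrite brDl !br_rtr /= Ex_same der_val_ad rtD brC addNr rt0.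
  + by rewrite rtD br_rtr /= der_val_ad brC uf_c_central oppr0 rt0.
- move=> [i|] [j|] a /=; first exact: hol_yyt.
  + by rewrite brDl !br_rtr /= Ey_same der_val_ad rtD brC addNr rt0.
  + by rewrite brDl !br_rtr /= Ey_same der_val_ad rtD brC addNr rt0.
  + by rewrite rtD br_rtr /= der_val_ad brC uf_c_central oppr0 rt0.
- by move=> i; rewrite leval_tf_diag hol_gen_diag.
Qed.

End StrandAction.

(** * Induction on u; the relations for the generators' images under eps and the section *)

Lemma uf_ind (K : fieldType) (X : Type) (LH : lieAlgType K) (hgen : X -> LH)
    (HLH : is_free_lie hgen) (S : uf LH -> Prop) :
    S 0 -> (forall a x y, S x -> S y -> S (a *: x + y)) ->
    (forall x y, S x -> S y -> S {[x, y]}) ->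
  (forall x, S (uf_gen hgen x)) -> S (uf_c LH) -> forall v, S v.
Proof.
move=> S0 SD Sbr Sgen Sc v; rewrite [v]uf_decomp; apply: (SD _ _ _) => //;
  move: v.1.
apply: (presented_ind HLH (S := fun v => S (v, 0))) => //
  [a x y Sx Sy|x y Sx Sy].
  by rewrite (lie_homP (@uf_inl_hom _ LH)); exact: SD.
by rewrite (lie_hom_br (@uf_inl_hom _ LH)); exact: Sbr.
Qed.

Lemma eps_gen_rel (K : fieldType) (g n : nat) (T' : lieAlgType K)
    (tg' : tgen g (idx0 n) -> T') s t :
    [pchar K] =i pred0 -> is_tf tg' ->
  tf_rel s t -> leval (eps_gen tg') s = leval (eps_gen tg') t.
Proof.
move=> char0 HT' /(tf_pull_rel char0 HT'.1 Some).
suff -> : tf_pull tg' Some = eps_gen tg' by [].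
have sum1 (F : idx0 n -> T') i :
    \sum_(p | Some p == i) F p = if i is Some j then F j else 0.
  case: i => [i|]; last by rewrite big_pred0.
  by rewrite (eq_bigl (pred1 i)) ?big_pred1_eq.
apply/funext => -[i j|a i|a i]; rewrite /= ?sum1; [|by case: i|by case: i].
by case: i => [i|]; case: j => [j|]; rewrite /= ?sum1.
Qed.

Lemma sec_gen_rel (K : fieldType) (g n : nat) (T : lieAlgType K)
    (tg : tgen g (idxs0 n) -> T) s t :
    [pchar K] =i pred0 -> is_tf tg ->
  tf_rel s t -> leval (sec_gen tg) s = leval (sec_gen tg) t.
Proof.
(* [odflt None] sends [*] to 0 and every other point to itself. *)
move=> char0 HT /(tf_pull_rel char0 HT.1 (odflt None)).
suff -> : tf_pull tg (odflt None) = sec_gen tg by [].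
have sum2 (F : idxs0 n -> T) i : \sum_(p | odflt None p == i) F p =
    if i is Some k then F (pts k) else F star + F zeros.
  by rewrite big_option /= big_pred1_eq; case: i => [i|]; rewrite //= add0r.
apply/funext => -[i j|a i|a i]; rewrite /= ?sum2; [|by case: i|by case: i].
case: i => [i|]; rewrite ?sum2; case: j => [j|] //.
(* The coefficient 2 of t_{*0} collects the two summands t_{*0} and t_{0*} of the pullback. *)
by rewrite (tf_tC HT.1 zeros star) scaler_nat mulr2n; zmod.
Qed.

(** * Injectivity of iota and exactness in the middle *)

Section Exactness.
Variables (K : fieldType) (g n : nat).
Hypothesis charK0 : [pchar K] =i pred0.
Variables (LH : lieAlgType K) (hgen : ugen g n -> LH).
Hypothesis HLH : is_free_lie hgen.
Variables (T : lieAlgType K) (tg : tgen g (idxs0 n) -> T).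
Hypothesis HT : is_tf tg.

Local Notation tau := (@tau K g n LH hgen).
Local Notation xi := (@xi K g n LH hgen).
Local Notation eta := (@eta K g n LH hgen).

(** Freeness gives the map on L(H); it extends to the line because t_** is central. *)
Lemma iota_exists : exists iota, is_iota hgen tg iota.
Proof.
have [|F [hF FE]] := HLH.2.1 T (iota_H tg); first by [].
exists (fun v => F v.1 + v.2 *: tg (Tg g star star)); split; last split.
- split=> [a v w|v w].
    by rewrite /= (lie_homP hF) scalerDl !scalerDr scalerA; zmod.
  rewrite /= (lie_hom_br hF) scale0r addr0 !(brDl, brDr, brZl, brZr).
  rewrite [{[F _, tg _]}]brC !(tf_tii_central charK0 HT).
  by rewrite oppr0 !scaler0 !addr0.
- by move=> h; rewrite /= FE scale0r addr0.
- by rewrite /= (lie_hom0 hF) scale1r add0r.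
Qed.

Variable iota : uf LH -> T.
Hypothesis Hiota : is_iota hgen tg iota.

Lemma iota_hom : lie_hom iota. Proof. exact: Hiota.1. Qed.
Lemma iota_gen h : iota (uf_gen hgen h) = iota_H tg h.
Proof. exact: Hiota.2.1. Qed.
Lemma iota_c : iota (uf_c LH) = tg (Tg g star star).
Proof. exact: Hiota.2.2. Qed.

(** For the point 0 this is the diagonal relation at [*], solved for t_{*0}. *)
Lemma iota_tau j : iota (tau j) = tg (Tg g (Some j) star).
Proof.
case: j => [k|]; first by rewrite tauS iota_gen.
have hi := iota_hom.
rewrite tau0 !(lie_homB hi) (lie_homZ hi) iota_c !(lie_hom_sum hi).
rewrite -(tf_diag HT.1) !big_option /=.
have -> : \sum_a iota {[xi a, eta a]} =
  \sum_a {[tg (Xg a star), tg (Yg a star)]}.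
  by apply: eq_bigr => a _; rewrite (lie_hom_br hi) !iota_gen.
rewrite [Z in _ - Z](eq_bigr (fun k => tg (Tg g star (pts k)))) => [|k _];
  last first.
  by rewrite iota_gen /= (tf_tC HT.1).
by rewrite [RHS](tf_tC HT.1); zmod.
Qed.

Lemma iota_inj : injective iota.
Proof.
have [E HE] := adj_exists HLH.
have [F [hF FE]] := HT.2.1 _ _ (hol_gen_rel HLH HE).
have Fi : F \o iota =1 @right_tr K (uf LH).
  apply: (uf_hom_ext HLH) => [||[k|a|a]|] /=.
  - exact: (lie_hom_comp hF iota_hom).
  - exact: right_tr_hom.
  - by rewrite iota_gen FE /= tauS.
  - by rewrite iota_gen FE.
  - by rewrite iota_gen FE.
  - by rewrite iota_c FE.
move=> v w e; have /(congr1 fst) /oppr_inj // : @right_tr K (uf LH) v =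
  right_tr w.
by rewrite -!Fi /= e.
Qed.

(** If [z] carries the index [*], then [tg z] is itself in the image, which is closed under
    brackets. Otherwise a defining relation either kills the bracket or rewrites it through
    generators of the strand [*]. *)
Lemma iota_ideal_gen z h : exists w, {[tg z, iota (uf_gen hgen h)]} = iota w.
Proof.
have hi := iota_hom; have i0 : exists w, 0 = iota w by exists 0;
  rewrite (lie_hom0 hi).
have star_im z' : (exists w, tg z' = iota w) ->
    exists w, {[tg z', iota (uf_gen hgen h)]} = iota w.
  by move=> [w ->]; exists {[w, uf_gen hgen h]}; rewrite (lie_hom_br hi).
have R := HT.1; case: z => [[i|] [j|]|a [i|]|a [i|]].
- case: h {star_im} => [k|a|a]; rewrite iota_gen /=; last first.
  + by rewrite brC (tf_yt R) ?oppr0.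
  + by rewrite brC (tf_xt R) ?oppr0.
  have tij p q : exists w, {[tg (Tg g (Some p) (Some q)),
    tg (Tg g (Some p) star)]} = iota w.
    have [->|pq] := eqVneq p q; first by rewrite (tf_tii_central charK0 HT).
    (* The four-term relation [t_{p*}, t_{pq} + t_{*q}] = 0 gives [t_{pq}, t_{p*}] =
       [t_{p*}, t_{q*}]. *)
    exists {[tau p, tau q]}; rewrite (lie_hom_br hi) !iota_tau.
    have := tf_4T R (i := Some p) (j := star) (k := Some q).
    rewrite brDr (tf_tC R star) [{[tg (Tg g (Some p) star), _]}]brC => e.
    by apply/eqP; rewrite -subr_eq0 -oppr_eq0 opprB addrC e // eq_sym.
  have [<-|ki] := eqVneq (Some k) i; first exact: tij.
  have [<-|kj] := eqVneq (Some k) j; first by rewrite (tf_tC R); exact: tij.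
  by rewrite (tf_tt R) //= eq_sym.
- by apply: star_im; exists (tau i); rewrite iota_tau.
- by apply: star_im; exists (tau j); rewrite iota_tau (tf_tC R).
- by apply: star_im; exists (uf_c LH); rewrite iota_c.
- case: h {star_im} => [k|b|b]; rewrite iota_gen /=.
  + have [->|ki] := eqVneq i (Some k); last by rewrite (tf_xt R).
    exists (- {[xi a, tau (Some k)]});
      rewrite (lie_homN hi) (lie_hom_br hi) iota_gen iota_tau.
    by apply/eqP; rewrite -addr_eq0 -brDl (tf_xxt R).
  + by rewrite (tf_xx R).
  + by rewrite (tf_xy R) //; case: eqP => // _; exists (tau i);
    rewrite iota_tau.
- by apply: star_im; exists (xi a); rewrite iota_gen.
- case: h {star_im} => [k|b|b]; rewrite iota_gen /=.
  + have [->|ki] := eqVneq i (Some k); last by rewrite (tf_yt R).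
    exists (- {[eta a, tau (Some k)]});
      rewrite (lie_homN hi) (lie_hom_br hi) iota_gen iota_tau.
    by apply/eqP; rewrite -addr_eq0 -brDl (tf_yyt R).
  + rewrite brC (tf_xy R) //; case: eqP => // _; last by rewrite oppr0.
    by exists (- tau i); rewrite (lie_homN hi) iota_tau (tf_tC R).
  + by rewrite (tf_yy R).
- by apply: star_im; exists (eta a); rewrite iota_gen.
Qed.

(** A double induction. By the Jacobi identity the elements [y] normalizing the image form a
    subalgebra; for a fixed generator [z], the elements [v] sent into the image form one too, since
    bracketing with [tg z] is a derivation. *)
Lemma iota_ideal y v : exists w, {[y, iota v]} = iota w.
Proof.
have hi := iota_hom; move: y v.
apply: (presented_ind HT (S := fun y => forall v, exists w, {[y, iota v]} =
  iota w)).
- by move=> v; exists 0; rewrite br0l (lie_hom0 hi).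
- move=> a x y Sx Sy v; have [[w1 e1] [w2 e2]] := (Sx v, Sy v).
  by exists (a *: w1 + w2); rewrite brDl brZl e1 e2 (lie_homP hi).
- move=> x y Sx Sy v; have [[w1 e1] [w2 e2]] := (Sx v, Sy v).
  have [[w3 e3] [w4 e4]] := (Sx w2, Sy w1).
  by exists (w3 - w4); rewrite br_brl e1 e2 e3 e4 (lie_homB hi).
move=> z; apply: (uf_ind HLH).
- by exists 0; rewrite (lie_hom0 hi) br0r.
- move=> a x y [w1 e1] [w2 e2]; exists (a *: w1 + w2).
  by rewrite (lie_homP hi) brDr brZr e1 e2 (lie_homP hi).
- move=> x y [w1 e1] [w2 e2]; exists ({[w1, y]} + {[x, w2]}).
  by rewrite (lie_homD hi) !(lie_hom_br hi) -e1 -e2 br_brr.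
- exact: iota_ideal_gen.
- by exists 0; rewrite iota_c (lie_hom0 hi) brC (tf_tii_central charK0 HT)
  oppr0.
Qed.

Variables (T' : lieAlgType K) (tg' : tgen g (idx0 n) -> T').
Hypothesis HT' : is_tf tg'.
Variables (eps : T -> T') (s : T' -> T).
Hypotheses (Heps : is_eps tg tg' eps) (Hs : is_sec tg tg' s).

Lemma eps_sec z : eps (s z) = z.
Proof.
have he := Heps.1; have eg := Heps.2.
apply: (presented_ext HT' (lie_hom_comp he Hs.1) (lie_hom_id T')) => y.
rewrite /= Hs.2; case: y => [[i|] [j|]|a [i|]|a [i|]];
  by rewrite /= ?(lie_homD he) ?(lie_homZ he) !eg /= ?scaler0 ?add0r.
Qed.

Lemma eps_iota v : eps (iota v) = 0.
Proof.
have h0 : lie_hom (fun _ : uf LH => 0 : T').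
  by split=> [a x y|x y]; rewrite ?scaler0 ?addr0 ?br0l.
apply: (uf_hom_ext HLH (lie_hom_comp Heps.1 iota_hom) h0) => [h|] /=.
  by rewrite iota_gen; case: h => [k|a|a]; rewrite Heps.2.
by rewrite iota_c Heps.2.
Qed.

Lemma iota_sec_span y : exists v z, y = iota v + s z.
Proof.
have hi := iota_hom; have hs := Hs.1; have sg := Hs.2.
move: y; apply: (presented_ind HT).
- by exists 0, 0; rewrite (lie_hom0 hi) (lie_hom0 hs) addr0.
- move=> a _ _ [v [z ->]] [w [y ->]]; exists (a *: v + w), (a *: z + y).
  by rewrite (lie_homP hi) (lie_homP hs) scalerDr; zmod.
- move=> _ _ [v [z ->]] [w [y ->]].
  (* The two mixed brackets lie in the image of [iota], because it is an ideal. *)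
  have [[v1 e1] [w1 f1]] := (iota_ideal (s y) v, iota_ideal (s z) w).
  exists ({[v, w]} + w1 - v1), {[z, y]}.
  rewrite (lie_homB hi) (lie_homD hi) -e1 -f1 (lie_hom_br hi) (lie_hom_br hs).
  by rewrite !(brDl, brDr) [{[iota v, s y]}]brC; zmod.
(* Three kinds of generators: [im] for those on the strand [*], [corr] for those at 0, whose image
   under the section needs a correction from [iota], and [corr0] for those that the section reaches
   exactly. *)
have im z v : iota v = tg z -> exists v z', tg z = iota v + s z'.
  by move=> <-; exists v, 0; rewrite (lie_hom0 hs) addr0.
have corr z v z' : s (tg' z') - iota v = tg z -> exists v z', tg z =
  iota v + s z'.
  by move=> <-; exists (- v), (tg' z'); rewrite (lie_homN hi) addrC.
have tC := tf_tC HT.1; have i0 := lie_hom0 hi.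
have corr0 z z' : s (tg' z') = tg z -> exists v z', tg z = iota v + s z'.
  by move=> e; apply: (corr z 0 z'); rewrite i0 subr0.
case=> [[[i|]|] [[j|]|]|a [[i|]|]|a [[i|]|]].
- by apply: (corr0 _ (Tg g (pt0 i) (pt0 j))); rewrite sg.
- by apply: (corr _ (tau (Some i)) (Tg g (pt0 i) zero0));
  rewrite sg iota_tau /=; zmod.
- by apply: (im _ (tau (Some i))); rewrite iota_tau.
- apply: (corr _ (tau (Some j)) (Tg g zero0 (pt0 j))).
  by rewrite sg iota_tau /= (tC star); zmod.
(* The section sends t_00 to t_** + 2 t_{*0} + t_00, and the first two terms are the correction. *)
- apply: (corr _ (uf_c LH + (tau None + tau None)) (Tg g zero0 zero0)).
  rewrite sg !(lie_homD hi) iota_c iota_tau /= scaler_nat mulr2n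
    (tC star zeros).
  by zmod.
- by apply: (im _ (tau None)); rewrite iota_tau.
- by apply: (im _ (tau (Some j))); rewrite iota_tau tC.
- by apply: (im _ (tau None)); rewrite iota_tau tC.
- by apply: (im _ (uf_c LH)); rewrite iota_c.
- by apply: (corr0 _ (Xg a (pt0 i))); rewrite sg.
- by apply: (corr _ (xi a) (Xg a zero0)); rewrite sg iota_gen /=; zmod.
- by apply: (im _ (xi a)); rewrite iota_gen.
- by apply: (corr0 _ (Yg a (pt0 i))); rewrite sg.
- by apply: (corr _ (eta a) (Yg a zero0)); rewrite sg iota_gen /=; zmod.
- by apply: (im _ (eta a)); rewrite iota_gen.
Qed.

Lemma eps_kernel y : eps y = 0 <-> exists v, iota v = y.
Proof.
split=> [|[v <-]]; last exact: eps_iota.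
have [v [z ->]] := iota_sec_span y.
rewrite (lie_homD Heps.1) eps_iota eps_sec add0r => ->.
by exists v; rewrite (lie_hom0 Hs.1) addr0.
Qed.

End Exactness.

Theorem theorem8p12 (K : fieldType) (charK0 : [pchar K] =i pred0) (g n : nat)
  (LH : lieAlgType K) (hgen : ugen g n -> LH) (HLH : is_free_lie hgen)
  (T : lieAlgType K) (tg : tgen g (idxs0 n) -> T) (HT : is_tf tg)
  (T' : lieAlgType K) (tg' : tgen g (idx0 n) -> T') (HT' : is_tf tg') :
  (exists iota, is_iota hgen tg iota) /\
  (exists eps, is_eps tg tg' eps) /\
  (exists s, is_sec tg tg' s) /\
  (forall (iota : uf LH -> T) (eps : T -> T') (s : T' -> T),
     is_iota hgen tg iota -> is_eps tg tg' eps -> is_sec tg tg' s ->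
     [/\ injective iota,
         (forall y : T, eps y = 0 <-> exists u, iota u = y),
         (forall z : T', exists y : T, eps y = z) &
         (forall z : T', eps (s z) = z)]).
Proof.
split; first exact: iota_exists.
split; first by apply: HT.2.1 => s t; exact: eps_gen_rel.
split; first by apply: HT'.2.1 => s t; exact: sec_gen_rel.
move=> iota eps s Hiota Heps Hs.
have epsK := eps_sec HT' Heps Hs.
split=> // [|y|z]; last by exists (s z).
  exact: iota_inj Hiota.
exact: (eps_kernel charK0 HLH HT Hiota HT' Heps Hs).
Qed.
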